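(* For $i\in\{1,2\}$ let $G_i$ be a finite graph on $n_i$ vertices and let $k_i$ be a natural number with $k_i\le n_i-2$. Then $\mathcal{B}_{\geq k_1}(G_1)\cong\mathcal{B}_{\geq k_2}(G_2)$ if and only if $G_1'\cong G_2'$ and either ($k_1\le\chi(G_1)$ and $k_2\le\chi(G_2)$) or $n_1-k_1=n_2-k_2$. Here $G_i'$ denotes the graph obtained from $G_i$ by removing all universal vertices.
   Context: All graphs are finite and simple; $\chi$ is the chromatic number. A vertex of $G$ is universal if it has degree $|V(G)|-1$. An independent set partition of $G$ is a partition of $V(G)$ into nonempty independent sets (parts). For such a partition $P$ and $v\in V(G)$, let $P-v$ be the partition of $V(G)\setminus\{v\}$ obtained by deleting $v$ from its part (discarding that part if it becomes empty). The Bell colouring graph $\mathcal{B}(G)$ has as vertices the independent set partitions of $G$, with $P\neq Q$ adjacent iff $P-v=Q-v$ for some $v\in V(G)$. For a natural number $k$, $\mathcal{B}_{\geq k}(G)$ is the induced subgraph of $\mathcal{B}(G)$ on the partitions with at least $k$ parts. *)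

(* Defs.v *)
From mathcomp Require Import all_boot.

Set Implicit Arguments.
Unset Strict Implicit.
Unset Printing Implicit Defensive.

Record sgraph := SGraph {
  vertex :> finType;
  adj : rel vertex;
  adj_sym : symmetric adj;
  adj_irr : irreflexive adj }.

Definition isomorphic (G H : sgraph) : Prop :=
  exists2 f : G -> H, bijective f & forall x y, adj (f x) (f y) = adj x y.

Section Induced.
Variables (G : sgraph) (A : {set G}).

Definition induced_adj : rel {x : G | x \in A} :=
  fun x y => adj (val x) (val y).

Lemma induced_sym : symmetric induced_adj.
Proof. by move=> x y; exact: adj_sym. Qed.

Lemma induced_irr : irreflexive induced_adj.
Proof. by move=> x; exact: adj_irr. Qed.

Definition induced : sgraph := SGraph induced_sym induced_irr.
End Induced.

Section Chromatic.
Variable G : sgraph.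

Definition colorable (k : nat) : bool :=
  [exists f : {ffun G -> 'I_k}, forall x, forall y, adj x y ==> (f x != f y)].

Lemma colorable_ex : exists k, colorable k.
Proof.
exists #|G|; apply/existsP; exists (finfun enum_rank).
apply/forallP => x; apply/forallP => y; apply/implyP; rewrite !ffunE.
by apply: contraTneq => /enum_rank_inj ->; rewrite adj_irr.
Qed.

Definition chi : nat := ex_minn colorable_ex.
End Chromatic.

Definition degree (G : sgraph) (v : G) : nat := #|[set w | adj v w]|.

Definition universal (G : sgraph) (v : G) : bool := degree v == #|G|.-1.

Definition remove_universal (G : sgraph) : sgraph :=
  induced [set v : G | ~~ universal v].

Definition independent (G : sgraph) (A : {set G}) : bool :=
  [forall x in A, forall y in A, ~~ adj x y].

(* [partition] already requires the parts to be nonempty. *)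
Definition independent_partition (G : sgraph) (P : {set {set G}}) : bool :=
  partition P [set: G] && [forall A in P, independent A].

Definition delete_vertex (T : finType) (P : {set {set T}}) (v : T) :
    {set {set T}} :=
  [set A :\ v | A in P] :\ set0.

Section Bell.
Variable G : sgraph.

Definition bell_vertex : finType :=
  {P : {set {set G}} | independent_partition P}.

Definition bell_adj : rel bell_vertex := fun P Q =>
  (P != Q) &&
  [exists v : G, delete_vertex (val P) v == delete_vertex (val Q) v].

Lemma bell_sym : symmetric bell_adj.
Proof.
move=> P Q; rewrite /bell_adj eq_sym; congr (_ && _).
by apply: eq_existsb => v; rewrite eq_sym.
Qed.

Lemma bell_irr : irreflexive bell_adj.
Proof. by move=> P; rewrite /bell_adj eqxx. Qed.

Definition bell : sgraph := SGraph bell_sym bell_irr.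

Definition bell_ge (k : nat) : sgraph :=
  induced [set P : bell | k <= #|val P|].
End Bell.

(* Main.v *)
Require Import Defs.
From mathcomp Require Import all_boot.

Set Implicit Arguments.
Unset Strict Implicit.
Unset Printing Implicit Defensive.

(** Let H be the complement of G.  The neighbours of the discrete partition are
    the edges of H, and two of them are adjacent iff the edges meet: its
    neighbourhood is the line graph of H.  Three pairwise meeting edges form a
    triangle rather than a star iff they have a common neighbour outside the
    closed neighbourhood of the discrete partition (this needs k <= n - 2).
    Edges, meeting and triangles determine H up to isolated vertices, that is,
    up to universal vertices of G.

    An isomorphism need not preserve the discrete partition, so we isolate
    local properties of it ([good]) which force every neighbour of its image P
    to come from an edge of H2, in such a way that adjacent neighbours come from
    meeting edges.  This gives an injection from the edges of H1 to those of H2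
    that preserves meeting, hence by counting, using the inverse isomorphism, a
    bijection that also reflects it.  Knowing this, triangles go to triangles, and
    counting again gives the converse.

    Once the graphs without universal vertices are identified, so are the
    partitions, the number of parts being shifted by n2 - n1; as every number of
    parts between chi and n occurs, the thresholds are compared by counting. *)

(** * Partitions as equivalence relations *)

(** Phrased through [pblock], this is an equivalence relation for every [P], with no partition
    hypothesis to carry along. *)
Definition same (T : finType) (P : {set {set T}}) : rel T :=
  fun x y => pblock P x == pblock P y.

(** For the relations of two partitions this becomes the equality [P - v = Q - v], by
    [delete_vertexP]. *)
Definition agree_off (T : eqType) (r s : rel T) (v : T) :=
  forall x y, x != v -> y != v -> r x y = s x y.

Section Partitions.
Variable T : finType.
Implicit Types (P Q : {set {set T}}) (x y v : T).

Lemma samexx P x : same P x x. Proof. exact: eqxx. Qed.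

Lemma same_sym P : symmetric (same P).
Proof. by move=> x y; rewrite /same eq_sym. Qed.

Lemma same_trans P : transitive (same P).
Proof. by move=> y x z /eqP xy /eqP yz; rewrite /same xy yz. Qed.

Lemma mem_pblock_same P x y :
  partition P setT -> (y \in pblock P x) = same P x y.
Proof.
move=> /and3P[/eqP cP tP _]; rewrite /same eq_pblock //.
by rewrite cP inE.
Qed.

Lemma partition_sameE P : partition P setT ->
  P = [set [set y | same P x y] | x : T].
Proof.
move=> pP; have /and3P[/eqP cP tP n0] := pP; apply/setP => A; apply/idP/imsetP.
  move=> AP; have [x xA] : exists x, x \in A.
    by apply/set0Pn; apply: contraNneq n0 => <-.
  exists x => //; apply/setP => y; rewrite inE -mem_pblock_same //.
  by rewrite (def_pblock tP AP xA).
move=> [x _ ->]; suff -> : [set y | same P x y] = pblock P x.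
  by apply: pblock_mem; rewrite cP inE.
by apply/setP => y; rewrite inE -mem_pblock_same.
Qed.

(** The nonempty sets [A :\ v] are the classes of [same P] on the vertices other than [v], so they
    determine this restricted relation and are determined by it. *)
Lemma delete_vertexP P Q v : partition P setT -> partition Q setT ->
  reflect (agree_off (same P) (same Q) v)
          (delete_vertex P v == delete_vertex Q v).
Proof.
have sub P' Q' : partition P' setT -> partition Q' setT ->
    agree_off (same P') (same Q') v ->
    delete_vertex P' v \subset delete_vertex Q' v.
  move=> pP pQ ag; apply/subsetP => B.
  rewrite !inE => /andP[B0 /imsetP[A AP defB]]; rewrite B0 /=.
  have [x xB] : exists x, x \in B by apply/set0Pn.
  have := xB; rewrite defB !inE => /andP[xv xA].
  apply/imsetP; exists (pblock Q' x).
    by have /and3P[/eqP cQ _ _] := pQ; apply: pblock_mem; rewrite cQ inE.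
  have /and3P[_ tP _] := pP.
  apply/setP => y; rewrite !inE; have [//|yv /=] := eqVneq y v.
  by rewrite mem_pblock_same // -ag // -mem_pblock_same // (def_pblock tP AP xA).
have half P' Q' x y : partition P' setT -> partition Q' setT ->
    delete_vertex P' v = delete_vertex Q' v -> x != v -> y != v ->
    same P' x y -> same Q' x y.
  move=> pP pQ ePQ xv yv; rewrite -mem_pblock_same // => yx.
  have /and3P[/eqP cP tP _] := pP; have /and3P[_ tQ _] := pQ.
  have : pblock P' x :\ v \in delete_vertex P' v.
    rewrite !inE; apply/andP; split.
      by apply/set0Pn; exists y; rewrite !inE yv.
    by apply: imset_f; apply: pblock_mem; rewrite cP inE.
  rewrite ePQ !inE => /andP[_ /imsetP[A AQ eA]].
  have xA : x \in A.
    have : x \in pblock P' x :\ v by rewrite !inE xv mem_pblock_same ?samexx.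
    by rewrite eA !inE => /andP[].
  have yA : y \in A.
    have : y \in pblock P' x :\ v by rewrite !inE yv.
    by rewrite eA !inE => /andP[].
  by rewrite -mem_pblock_same // (def_pblock tQ AQ xA).
move=> pP pQ; apply: (iffP eqP) => [ePQ x y xv yv | ag].
  by apply/idP/idP; apply: half.
apply/eqP; rewrite eqEsubset !sub //.
by move=> x y xv yv; rewrite ag.
Qed.

Lemma partition_same_inj P Q : partition P setT -> partition Q setT ->
  same P =2 same Q -> P = Q.
Proof.
move=> pP pQ ePQ; rewrite (partition_sameE pP) (partition_sameE pQ).
by apply: eq_imset => x; apply/setP => y; rewrite !inE ePQ.
Qed.

(** Pairwise inequivalent vertices stand in for counting parts: they bound the number of parts from
    below, and by [exists_transversal] the bound is attained. *)
Lemma leq_card_partition P (S : {set T}) : partition P setT ->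
  {in S &, forall x y, same P x y -> x = y} -> #|S| <= #|P|.
Proof.
move=> pP injS; have /and3P[/eqP cP _ _] := pP.
rewrite -(card_in_imset (f := pblock P) (D := S)).
  apply: subset_leq_card; apply/subsetP => _ /imsetP[x _ ->].
  by apply: pblock_mem; rewrite cP inE.
by move=> x y xS yS /eqP; apply: injS.
Qed.

Lemma exists_transversal P : partition P setT -> exists2 S : {set T},
  {in S &, forall x y, same P x y -> x = y} & #|S| = #|P|.
Proof.
move=> pP; have tr := transversalP pP.
exists (transversal P setT); last exact: card_transversal tr.
by move=> x y xS yS /eqP; apply: (pblock_inj tr).
Qed.

Lemma exists_partition (rT : eqType) (f : T -> rT) :
  exists2 P : {set {set T}},
    partition P setT & forall x y, same P x y = (f x == f y).
Proof.
have pP := preim_partitionP f setT; exists (preim_partition f setT) => // x y.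
rewrite -mem_pblock_same // pblock_equivalence_partition ?inE //.
by move=> ? ? ? _ _ _; split=> [//|/eqP->].
Qed.

End Partitions.

(** * Vertices of the Bell colouring graph as equivalence relations *)

Section BellGe.
Variables (G : sgraph) (k : nat).
Local Notation V := (bell_ge G k).
Implicit Types (P Q R : V) (x y v : G).

Definition rl P : rel G := same (val (val P)).

Lemma V_part P : partition (val (val P)) [set: G].
Proof. by case/andP: (valP (val P)). Qed.

Lemma V_card P : k <= #|val (val P)|.
Proof. by have := valP P; rewrite inE. Qed.

Lemma rlxx P x : rl P x x. Proof. exact: samexx. Qed.
Lemma rlC P x y : rl P x y = rl P y x. Proof. exact: same_sym. Qed.
Lemma rl_trans P x y z : rl P x y -> rl P y z -> rl P x z.
Proof. by move=> xy yz; apply: same_trans xy yz. Qed.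

Lemma rl_congr P x y z : rl P x y -> rl P x z = rl P y z.
Proof.
move=> xy; apply/idP/idP; last exact: rl_trans.
by apply: rl_trans; rewrite rlC.
Qed.

Lemma rl_nadj P x y : rl P x y -> ~~ adj x y.
Proof.
rewrite /rl -mem_pblock_same ?V_part // => xy.
have /andP[pP /forall_inP/(_ (pblock (val (val P)) x))] := valP (val P).
have /and3P[/eqP cP _ _] := pP.
rewrite pblock_mem ?cP ?inE // => /(_ isT)/forall_inP/(_ x).
by rewrite mem_pblock_same // samexx => /(_ isT)/forall_inP/(_ y xy).
Qed.

Lemma rl_inj P Q : rl P =2 rl Q -> P = Q.
Proof.
by move=> e; do 2!apply: val_inj; apply: partition_same_inj e; apply: V_part.
Qed.

Lemma V_adjP P Q :
  reflect (P <> Q /\ exists v, agree_off (rl P) (rl Q) v) (adj P Q).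
Proof.
rewrite /= /induced_adj /= /bell_adj.
apply: (iffP andP) => [[/eqP nPQ /existsP[v /delete_vertexP ag]] | [nPQ [v ag]]].
  by split; [move=> e; apply: nPQ; rewrite e | exists v; apply: ag; apply: V_part].
split; first by apply/eqP => e; apply: nPQ; apply: val_inj.
by apply/existsP; exists v; apply/delete_vertexP => //; apply: V_part.
Qed.

(** Partitions are built as the fibres of a function; the elements of [S] lie in different fibres
    and so certify the threshold. *)
Lemma exists_V (rT : eqType) (f : G -> rT) (S : {set G}) :
  (forall x y, f x = f y -> ~~ adj x y) ->
  {in S &, injective f} -> k <= #|S| ->
  exists P, forall x y, rl P x y = (f x == f y).
Proof.
move=> pf injS kS; have [P pP eP] := exists_partition f.
have iP : independent_partition P.
  apply/andP; split=> //; apply/forall_inP => A AP.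
  apply/forall_inP => x xA; apply/forall_inP => y yA; apply: pf.
  have /and3P[_ tP _] := pP.
  by apply/eqP; rewrite -eP -mem_pblock_same // (def_pblock tP AP xA).
pose P1 : bell G := Sub P iP.
have kP : P1 \in [set P : bell G | k <= #|val P|].
  rewrite inE; apply: leq_trans kS _; apply: leq_card_partition => // x y xS yS.
  by rewrite eP => /eqP; apply: injS.
by exists (Sub P1 kP).
Qed.

Lemma V_transversal P : exists2 S : {set G},
  {in S &, forall x y, rl P x y -> x = y} & k <= #|S|.
Proof.
by have [S injS cS] := exists_transversal (V_part P);
   exists S; rewrite // cS V_card.
Qed.

(** The effect of making [e] a part and deleting its vertices from all other parts. *)
Definition isorel (r : rel G) (e : {set G}) : rel G := fun x y =>
  if (x \in e) || (y \in e) then (x \in e) && (y \in e) else r x y.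

(** The map [g] carries a transversal of [P] to pairwise inequivalent vertices of the new partition,
    which therefore has at least as many parts as [P]. *)
Lemma exists_iso P (e : {set G}) (g : G -> G) :
  independent e ->
  (forall x y, isorel (rl P) e (g x) (g y) -> rl P x y) ->
  exists Q, forall x y, rl Q x y = isorel (rl P) e x y.
Proof.
move=> ie gP; have [S injS kS] := V_transversal P.
pose f x := if x \in e then None else Some (pblock (val (val P)) x).
have fE x y : (f x == f y) = isorel (rl P) e x y.
  by rewrite /f /isorel; case: (x \in e); case: (y \in e).
have [|||Q eQ] := @exists_V _ f (g @: S).
- move=> x y /eqP; rewrite fE /isorel; case: ifP => _; last exact: rl_nadj.
  by case/andP => xe ye; move/forall_inP/(_ x xe)/forall_inP: ie; apply.
- move=> _ _ /imsetP[x xS ->] /imsetP[y yS ->] /eqP; rewrite fE => /gP.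
  by move/injS => ->.
- rewrite card_in_imset // => x y xS yS gxy; apply: injS => //; apply: gP.
  by rewrite gxy -fE.
by exists Q => x y; rewrite eQ fE.
Qed.

End BellGe.

(** * Partitions that look locally like the discrete one *)

Section Local.
Variable B : sgraph.
Implicit Types P Q R : B.

Definition far P R := (R != P) && ~~ adj P R.

Definition cofar P Q1 Q2 Q3 :=
  exists R, [/\ far P R, adj R Q1, adj R Q2 & adj R Q3].

(* Stated inside the abstract graph, so that isomorphisms preserve it. *)
Definition good P :=
  [/\ forall Q1 Q2, adj P Q1 -> adj P Q2 -> Q1 != Q2 -> ~~ adj Q1 Q2 ->
        exists R, [/\ far P R, adj R Q1 & adj R Q2],
      forall Q1 Q2 R1 R2, adj P Q1 -> adj P Q2 -> Q1 != Q2 -> ~~ adj Q1 Q2 ->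
        far P R1 -> adj R1 Q1 -> adj R1 Q2 ->
        far P R2 -> adj R2 Q1 -> adj R2 Q2 -> R1 = R2 &
      forall Q1 Q2 Q3 Q4, adj P Q1 -> adj P Q2 -> adj P Q3 -> adj P Q4 ->
        adj Q1 Q2 -> adj Q2 Q3 -> adj Q1 Q3 -> cofar P Q1 Q2 Q3 ->
        Q4 != Q1 -> adj Q4 Q1 ->
        [|| Q4 == Q2, Q4 == Q3, adj Q4 Q2 | adj Q4 Q3]].
End Local.

Ltac rlsimp := repeat (match goal with
 | |- context [?x == ?x] => rewrite eqxx
 | H : is_true (?x != ?y) |- context [?x == ?y] => rewrite (negbTE H)
 | H : is_true (?x != ?y) |- context [?y == ?x] => rewrite (eq_sym y x) (negbTE H)
 | H : is_true (rl ?P ?x ?y) |- context [rl ?P ?x ?y] => rewrite H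
 | H : is_true (rl ?P ?x ?y) |- context [rl ?P ?y ?x] => rewrite (rlC P y x) H
 | H : is_true (~~ rl ?P ?x ?y) |- context [rl ?P ?x ?y] => rewrite (negbTE H)
 | H : is_true (~~ rl ?P ?x ?y) |- context [rl ?P ?y ?x] =>
     rewrite (rlC P y x) (negbTE H)
 end; rewrite /=).

Ltac isosimp := rewrite /isorel ?inE; rlsimp; rewrite ?orbF ?andbF ?orbT ?andbT //.

(** * The parts of a good partition *)

Section Good.
Variables (G : sgraph) (k : nat).
Local Notation V := (bell_ge G k).
Implicit Types (P Q R : V) (x y v : G).

Lemma V_adjI P Q v : P != Q -> agree_off (rl P) (rl Q) v -> adj P Q.
Proof. by move=> /eqP nPQ ag; apply/V_adjP; split=> //; exists v. Qed.

Lemma neqI P Q x y : rl P x y != rl Q x y -> P != Q.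
Proof. by apply: contraNneq => ->. Qed.

(** The two pairs are disjoint, so whichever vertex is deleted, one of them survives. *)
Lemma nadjI P Q a b c d : rl P a b != rl Q a b -> rl P c d != rl Q c d ->
  [&& a != c, a != d, b != c & b != d] -> ~~ adj P Q.
Proof.
move=> ab cd /and4P[ac ad bc bd]; apply/V_adjP => -[_ [v ag]].
have [va|av] := eqVneq a v.
  by move/eqP: cd; apply; apply: ag; rewrite eq_sym -va.
have [vb|bv] := eqVneq b v.
  by move/eqP: cd; apply; apply: ag; rewrite eq_sym -vb.
by move/eqP: ab; apply; apply: ag.
Qed.

Lemma farI P Q a b c d : rl P a b != rl Q a b -> rl P c d != rl Q c d ->
  [&& a != c, a != d, b != c & b != d] -> far P Q.
Proof.
move=> ab cd dj; rewrite /far (nadjI ab cd dj) andbT.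
by apply: (@neqI Q P a b); rewrite eq_sym.
Qed.

Lemma indep1 x : independent [set x : G].
Proof.
by apply/forall_inP => a /set1P->; apply/forall_inP => b /set1P->;
   rewrite adj_irr.
Qed.

Lemma indep2 x y : independent [set x; y] = ~~ adj x y.
Proof.
apply/idP/idP => [/forall_inP/(_ x)|xy].
  by rewrite set21 => /(_ isT)/forall_inP/(_ y); rewrite set22 => /(_ isT).
apply/forall_inP => a /set2P[]->; apply/forall_inP => b /set2P[]->;
  by rewrite ?adj_irr // adj_sym.
Qed.

(** Splitting a vertex off never lowers the number of parts, so the identity serves as the map of
    representatives. *)
Lemma exists_split P x :
  exists Q, forall y z, rl Q y z = isorel (rl P) [set x] y z.
Proof.
apply: (@exists_iso _ _ P [set x] id) (indep1 x) _ => y z.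
rewrite /isorel !inE; case: eqP => [->|_]; case: eqP => [->|_] //=.
by rewrite rlxx.
Qed.

Lemma split_agree P Q x : rl Q =2 isorel (rl P) [set x] ->
  agree_off (rl Q) (rl P) x.
Proof. by move=> eQ y z yx zx; rewrite eQ; isosimp. Qed.

Lemma split_adj P Q x y : rl Q =2 isorel (rl P) [set x] -> x != y ->
  rl P x y -> adj P Q.
Proof.
move=> eQ xy Pxy; rewrite adj_sym; apply: V_adjI (split_agree eQ).
by apply: (@neqI Q P x y); rewrite eQ; isosimp.
Qed.

Lemma far_agree P R v : far P R -> agree_off (rl R) (rl P) v -> False.
Proof.
case/andP=> nRP /V_adjP nadj ag; apply: nadj; split.
  by move=> e; rewrite e eqxx in nRP.
by exists v => x y xv yv; rewrite ag.
Qed.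

Section GoodStructure.
Variables (P : V) (gP : good P).

(* The neighbours splitting off [a] and [x] would have two far common neighbours:
   one splits off both vertices, the other makes [{a, x}] a part. *)
Lemma good_no_disjoint_mates a b x y : rl P a b -> rl P x y -> ~~ adj a x ->
  a != b -> x != y -> a != x -> a != y -> b != x -> b != y -> False.
Proof.
move=> Pab Pxy nax ab xy ax ay bx bY.
have [Q1 eQ1] := exists_split P a.
have [Q2 eQ2] := exists_split P x.
have [R1 eR1] := exists_split Q1 x.
(* The mates [b] and [y] stay outside [{a, x}] and represent the parts that [a] and [x] leave, so no
   part is emptied. *)
have [R2 eR2] : exists R, forall y z, rl R y z = isorel (rl P) [set a; x] y z.
  pose g z := if z == a then b else if z == x then y else z.
  have gP' z : rl P (g z) z.
    rewrite /g; case: eqP => [->|_]; first by rlsimp.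
    by case: eqP => [->|_]; rlsimp; rewrite ?rlxx.
  have gn z : g z \notin [set a; x].
    by rewrite !inE /g; case: ifP => [_|/negbT za]; [|case: ifP => [_|/negbT zx]];
       rlsimp.
  apply: (exists_iso (g := g)); first by rewrite indep2.
  move=> z w; rewrite /isorel !(negbTE (gn _)) /=.
  by rewrite (rl_congr _ (gP' z)) rlC (rl_congr _ (gP' w)) rlC.
have [_ uniq _] := gP.
suff e12 : R1 = R2.
  have : rl R1 a x = rl R2 a x by rewrite e12.
  by rewrite eR1 eR2; isosimp.
have A1 : agree_off (rl R1) (rl Q2) a.
  move=> z w za wa; rewrite eR1 eQ2 /isorel !inE eQ1.
  by case: ifP => //; isosimp.
have A2 : agree_off (rl R2) (rl Q1) x.
  by move=> z w za wa; rewrite eR2 eQ1; isosimp.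
have A3 : agree_off (rl R2) (rl Q2) a.
  by move=> z w za wa; rewrite eR2 eQ2; isosimp.
apply: (uniq Q1 Q2); rewrite ?(split_adj eQ1 ab) ?(split_adj eQ2 xy) //.
- by apply: (@neqI _ _ a b); rewrite eQ1 eQ2; isosimp.
- by apply: (@nadjI _ _ a b x y); rewrite ?eQ1 ?eQ2; isosimp.
- by apply: (@farI _ _ a b x y); rewrite ?eR1; isosimp; rewrite ?eQ1; isosimp.
- apply: V_adjI (split_agree eR1); apply: (@neqI _ _ x y).
  by rewrite eR1; isosimp; rewrite eQ1; isosimp.
- apply: V_adjI A1; apply: (@neqI _ _ a b).
  by rewrite eR1 eQ2; isosimp; rewrite eQ1; isosimp.
- by apply: (@farI _ _ a b x y); rewrite ?eR2; isosimp.
- by apply: V_adjI A2; apply: (@neqI _ _ x y); rewrite eR2 eQ1; isosimp.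
- by apply: V_adjI A3; apply: (@neqI _ _ a b); rewrite eR2 eQ2; isosimp.
Qed.

(** Four vertices of one part would form two disjoint pairs of mates, with [a] and [c] nonadjacent
    because they share a part. *)
Lemma good_class3 a b c d : rl P a b -> rl P a c -> rl P a d ->
  a != b -> a != c -> b != c -> d \in [:: a; b; c].
Proof.
move=> Pab Pac Pad ab ac bc; rewrite !inE; apply/negPn/negP.
rewrite !negb_or => /and3P[da db dc].
apply: (@good_no_disjoint_mates a b c d) => //; rewrite 1?eq_sym //.
  by rewrite -(rl_congr _ Pac).
exact: rl_nadj Pac.
Qed.

(* Splitting off [a], [b] or [c] gives three pairwise adjacent neighbours with a
   far common neighbour; moving [a] next to [x] is adjacent to the first only. *)
Lemma good_triple_isolated a b c x : rl P a b -> rl P a c -> a != b -> a != c ->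
  b != c -> ~~ rl P a x -> adj a x.
Proof.
move=> Pab Pac ab ac bc Pax; apply: contraT => nax.
have ax : a != x by apply: contraNneq Pax => <-; exact: rlxx.
have Pbx : ~~ rl P b x by rewrite -(rl_congr _ Pab).
have Pcx : ~~ rl P c x by rewrite -(rl_congr _ Pac).
have Pbc : rl P b c by rewrite -(rl_congr _ Pab).
have bx : b != x by apply: contraNneq Pbx => <-; exact: rlxx.
have cx : c != x by apply: contraNneq Pcx => <-; exact: rlxx.
(* A mate of [x] would give two disjoint pairs of mates, so [x] is a part by itself. *)
have [/existsP[y /andP[xy Pxy]]|/existsPn alone] :=
    boolP [exists y, (x != y) && rl P x y].
  case: (@good_no_disjoint_mates a b x y) => //.
    by apply: contraNneq Pax => ->; rewrite rlC.
  by apply: contraNneq Pbx => ->; rewrite rlC.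
have {alone} xalone z : rl P x z = (x == z).
  have := alone z; case: eqP => [->|_]; first by rewrite rlxx.
  by move/negbTE.
have cl z : rl P a z -> z \in [:: a; b; c] by move=> Paz; apply: good_class3.
have [Q1 eQ1] := exists_split P a.
have [Q2 eQ2] := exists_split P b.
have [Q3 eQ3] := exists_split P c.
have [R0 eR0] := exists_split Q1 b.
have [Q4 eQ4] : exists R, forall y z, rl R y z = isorel (rl P) [set a; x] y z.
  (* [b] represents the part that [a] leaves and [x] the new part [{a, x}], so the number of parts
     does not drop. *)
  pose g z := if z == a then b else z.
  apply: (exists_iso (g := g)); first by rewrite indep2.
  move=> z w; rewrite /g /isorel !inE.
  have ez u : rl P (if u == a then b else u) u.
    by case: eqP => [->|_]; rlsimp; rewrite ?rlxx.
  have eg u : ((if u == a then b else u) == a) = false.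
    by case: ifP => // _; rlsimp.
  have ex u : ((if u == a then b else u) == x) = (u == x).
    by have [->|ua] := eqVneq u a; rlsimp.
  rewrite !eg !ex /=.
  case: eqP => [->|_]; case: eqP => [->|_] //=; first by rewrite rlxx.
  by rewrite (rl_congr _ (ez z)) rlC (rl_congr _ (ez w)) rlC.
have mates a' b' c' z : rl P a' b' -> rl P a' c' -> a' != b' -> a' != c' ->
    b' != c' -> rl P b' z -> z != b' -> z != c' -> z = a'.
  move=> Pab' Pac' ab' ac' bc' Pbz zb zc.
  have : z \in [:: a'; b'; c'] by apply: good_class3; rewrite // (rl_congr _ Pab').
  by rewrite !inE (negbTE zb) (negbTE zc) !orbF => /eqP.
(* Splitting off one of two vertices of a triple, or the other one, gives
   partitions that agree off the third. *)
have splitsA a' b' c' Q Q' : rl P a' b' -> rl P a' c' -> a' != b' -> a' != c' ->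
    b' != c' -> rl Q =2 isorel (rl P) [set b'] ->
    rl Q' =2 isorel (rl P) [set c'] -> agree_off (rl Q) (rl Q') a'.
  move=> Pab' Pac' ab' ac' bc' eQ eQ'.
  have cl' z : rl P a' z -> z \in [:: a'; b'; c'].
    by move=> ?; apply: good_class3.
  have Pbc' : rl P b' c' by rewrite -(rl_congr _ Pab').
  move=> z w za wa; rewrite eQ eQ' /isorel !inE.
  have nb u : u != a' -> u != b' -> u != c' -> rl P a' u = false.
    by move=> ua ub uc; apply/negP => /cl'; rewrite !inE; rlsimp.
  have [->|zb] := eqVneq z b'; have [->|wb] := eqVneq w b'; isosimp; rewrite ?rlxx //.
  - have [//|wc] := eqVneq w c'; by rewrite -(rl_congr _ Pab') nb.
  - have [//|zc] := eqVneq z c'; by rewrite rlC -(rl_congr _ Pab') nb.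
  - have [ze|zc] := eqVneq z c'; have [we|wc] := eqVneq w c'; rewrite //=.
    + by rewrite ze we rlxx.
    + by rewrite ze -(rl_congr _ Pac') nb.
    + by rewrite we rlC -(rl_congr _ Pac') nb.
have splits a' b' c' Q Q' : rl P a' b' -> rl P a' c' -> a' != b' -> a' != c' ->
    b' != c' -> rl Q =2 isorel (rl P) [set b'] ->
    rl Q' =2 isorel (rl P) [set c'] -> adj Q Q'.
  move=> Pab' Pac' ab' ac' bc' eQ eQ'.
  apply: (V_adjI _ (splitsA a' b' c' Q Q' Pab' Pac' ab' ac' bc' eQ eQ')).
  by apply: (@neqI _ _ a' b'); rewrite eQ eQ'; isosimp.
have Q4P : adj P Q4.
  rewrite adj_sym; apply: (@V_adjI _ _ a).
    by apply: (@neqI _ _ a x); rewrite eQ4; isosimp.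
  move=> z w za wa; rewrite eQ4; isosimp.
  have [->|zx] := eqVneq z x; first by rewrite /= xalone eq_sym.
  by have [->|wx] := eqVneq w x; rewrite //= rlC xalone; rlsimp.
have Q41 : adj Q4 Q1.
  apply: (@V_adjI _ _ a).
    by apply: (@neqI _ _ a x); rewrite eQ4 eQ1; isosimp.
  move=> z w za wa; rewrite eQ4 eQ1; isosimp.
  have [->|zx] := eqVneq z x; first by rewrite /= xalone eq_sym.
  by have [->|wx] := eqVneq w x; rewrite //= rlC xalone; rlsimp.
have [_ _ gtri] := gP.
have /or4P[/eqP e|/eqP e|h|h] : [|| Q4 == Q2, Q4 == Q3, adj Q4 Q2 | adj Q4 Q3].
  apply: (gtri Q1) => //.
  - exact: split_adj eQ1 ab Pab.
  - by apply: (split_adj eQ2 bc).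
  - by apply: (split_adj eQ3 (y := a)); rewrite 1?eq_sym // rlC.
  - by apply: (splits c a b) => //; rlsimp; rewrite 1?eq_sym // rlC.
  - exact: (splits a b c).
  - by apply: (splits b a c) => //; rlsimp; rewrite 1?eq_sym // rlC.
  (* [R0] breaks the triple into singletons, so it differs from [P] on all three pairs, and no
     vertex lies in all of them. *)
  - exists R0; split.
    + have ca : rl R0 c a = false by rewrite eR0; isosimp; rewrite eQ1; isosimp.
      have cb : rl R0 c b = false by rewrite eR0; isosimp.
      have ab0 : rl R0 a b = false by rewrite eR0; isosimp.
      apply/andP; split.
        by apply: (@neqI _ _ a b); rewrite ab0; rlsimp.
      apply/V_adjP => -[_ [v ag]].
      have [va|av] := eqVneq a v.
        have : rl P c b = rl R0 c b by apply: ag; rewrite -va eq_sym.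
        by rewrite cb; rlsimp.
      have [vb|bv] := eqVneq b v.
        have : rl P c a = rl R0 c a by apply: ag; rewrite -vb // eq_sym.
        by rewrite ca; rlsimp.
      by have := ag a b av bv; rewrite ab0; rlsimp.
    + apply: V_adjI (split_agree eR0).
      by apply: (@neqI _ _ b c); rewrite eR0 eQ1; isosimp.
    + apply: (@V_adjI _ _ a).
        by apply: (@neqI _ _ a c); rewrite eR0 eQ2; isosimp; rewrite eQ1; isosimp.
      move=> z w za wa; rewrite eR0 eQ2 /isorel !inE eQ1.
      by case: ifP => //; isosimp.
    + apply: (@V_adjI _ _ a).
        by apply: (@neqI _ _ a b); rewrite eR0 eQ3; isosimp.
      move=> z w za wa; rewrite -(splitsA a b c Q2 Q3) //.
      rewrite eR0 eQ2 /isorel !inE eQ1.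
      by case: ifP => //; isosimp.
  - by apply: (@neqI _ _ a x); rewrite eQ4 eQ1; isosimp.
- have : rl Q4 a x = rl Q2 a x by rewrite e.
  by rewrite eQ4 eQ2; isosimp.
- have : rl Q4 a x = rl Q3 a x by rewrite e.
  by rewrite eQ4 eQ3; isosimp.
- by move: h; apply/contraLR => _; apply: (@nadjI _ _ a x b c);
     rewrite ?eQ4 ?eQ2; isosimp.
- by move: h; apply/contraLR => _; apply: (@nadjI _ _ a x b c);
     rewrite ?eQ4 ?eQ3; isosimp.
Qed.

(* Otherwise the nonadjacent neighbours [a|b|x] and [abx] would have no far common
   neighbour. *)
Lemma good_pair_not_extended Q a b x : adj P Q -> a != b ->
  (forall z, rl P a z = (z \in [:: a; b])) -> (forall z, rl P x z = (x == z)) ->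
  agree_off (rl Q) (rl P) x -> rl Q x a -> x != a -> False.
Proof.
move=> PQ ab cla xal ag Qxa xa.
have Pab : rl P a b by rewrite cla !inE eqxx orbT.
have xb : x != b by apply: contraNneq xa => xb; move: Pab; rewrite rlC -xb xal.
have Qab : rl Q a b by rewrite ag // eq_sym.
have Qxb : rl Q x b by exact: rl_trans Qxa Qab.
have clb z : rl P b z = (z \in [:: a; b]) by rewrite -(rl_congr _ Pab) cla.
have xal' z : rl P z x = (x == z) by rewrite rlC xal.
have [Q1 eQ1] := exists_split P a.
have Q1ab : ~~ rl Q1 a b by rewrite eQ1; isosimp.
have Q1ax : ~~ rl Q1 a x by rewrite eQ1; isosimp.
have Q1bx : ~~ rl Q1 b x by rewrite eQ1; isosimp; rewrite xal'; rlsimp.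
have PQ1 : adj P Q1 by exact: split_adj eQ1 ab Pab.
have nQ1Q : Q1 != Q by apply: (@neqI _ _ a b); rlsimp.
have nadjQ : ~~ adj Q1 Q.
  apply/V_adjP => -[_ [v agv]].
  have [va|av] := eqVneq v a.
    by have := agv b x; rewrite va xa eq_sym ab => /(_ isT isT); rlsimp.
  have [vb|bv] := eqVneq v b.
    by have := agv a x; rewrite vb xb ab => /(_ isT isT); rlsimp.
  by have := agv a b; rewrite eq_sym av eq_sym bv => /(_ isT isT); rlsimp.
have [gex _ _] := gP; have [R [fR]] := gex _ _ PQ1 PQ nQ1Q nadjQ.
move=> /V_adjP[_ [p ap]] /V_adjP[_ [q aq]].
have far' v : agree_off (rl R) (rl P) v -> False by exact: far_agree fR.
have Q1a : agree_off (rl Q1) (rl P) a by exact: split_agree.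
have Q1b : agree_off (rl Q1) (rl P) b.
  move=> y z yb zb; rewrite eQ1; isosimp.
  have [->|ya] := eqVneq y a; first by rewrite cla !inE; rlsimp; rewrite orbF.
  by have [->|za] := eqVneq z a; rewrite // rlC cla !inE; rlsimp.
have agT (S : V) v : agree_off (rl R) (rl S) v -> agree_off (rl S) (rl P) v -> False.
  by move=> h1 h2; apply: (far' v) => y z yv zv; rewrite h1 ?h2.
(* [Q1] agrees with [P] off [a] and off [b], and [Q] does so off [x]; if [R] differed from one of
   them only at such a vertex, it would not be far from [P]. *)
have pa : p != a by apply/eqP => e; apply: (agT Q1 a); rewrite // -e.
have pb : p != b by apply/eqP => e; apply: (agT Q1 b); rewrite // -e.
have qx : q != x by apply/eqP => e; apply: (agT Q x); rewrite // -e.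
have Rab : ~~ rl R a b by rewrite ap // eq_sym.
(* [R] separates [a] from [b], as [Q1] does, while [Q] joins them. *)
have qab : (q == a) || (q == b).
  apply: contraNT Rab; rewrite negb_or => /andP[qa qb].
  by rewrite aq // eq_sym.
have [px|px] := eqVneq p x; last first.
  have Rax : ~~ rl R a x by rewrite ap // eq_sym.
  have Rbx : ~~ rl R b x by rewrite ap // eq_sym.
  case/orP: qab => /eqP qe; [move: Rbx | move: Rax]; rewrite aq ?qe //;
    by rewrite 1?eq_sym // rlC ?Qxa ?Qxb.
rewrite px in ap.
(* So [R] is [P] with the vertex of the pair other than [q] moved next to [x]. *)
have mv c d : agree_off (rl R) (rl Q) c -> rl Q x d -> c != d ->
    d != x -> c != x -> (forall z, rl P d z = (z == c) || (z == d)) ->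
    agree_off (rl Q1) (rl P) d -> ~~ rl Q1 c d -> False.
  move=> aR Qxd cd dx cx cld aQ1 nQ1.
  have Rxc : ~~ rl R x c.
    apply: contra nQ1 => Rxc; rewrite -ap // -(rl_congr _ Rxc) aR //.
      by rewrite eq_sym.
    by rewrite eq_sym.
  have Rx z : z != d -> rl R x z = rl P x z.
    move=> zd; have [->|zc] := eqVneq z c; first by rewrite xal; rlsimp.
    have [->|zx] := eqVneq z x; first by rewrite !rlxx.
    rewrite aR ?(eq_sym x c) // (rl_congr _ Qxd) ag // cld xal.
    by rlsimp.
  apply: (far' d) => y z yd zd.
  have [->|yx] := eqVneq y x; first exact: Rx.
  have [->|zx] := eqVneq z x; first by rewrite rlC Rx // rlC.
  by rewrite ap // aQ1.
case/orP: qab => /eqP qe; rewrite qe in aq.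
  by apply: (mv a b) => //; first [by rewrite eq_sym | by move=> z; rewrite clb !inE].
apply: (mv b a) => //; first [by rewrite eq_sym | by rewrite rlC | move=> z].
by rewrite cla !inE orbC.
Qed.

End GoodStructure.
End Good.

(** * Neighbours of a good partition *)

Definition coedge (G : sgraph) : finType :=
  {e : {set G} | (#|e| == 2) && independent e}.

Section Moves.
Variables (G : sgraph) (k : nat).
Local Notation V := (bell_ge G k).
Implicit Types (P Q R : V) (x y v : G).

Lemma coedgeP (e : coedge G) (x : G) : x \in val e ->
  exists y, [/\ val e = [set x; y], x != y & ~~ adj x y].
Proof.
have /andP[/cards2P[a [b [ab ee]]] ie] := valP e.
have nab : ~~ adj a b by rewrite -indep2 -ee.
rewrite ee => /set2P[]->; [exists b|exists a]; split=> //.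
- by rewrite setUC.
- by rewrite eq_sym.
- by rewrite adj_sym.
Qed.

Lemma coedge_ex (e : coedge G) :
  exists x y, [/\ val e = [set x; y], x != y & ~~ adj x y].
Proof.
have /andP[/cards2P[a [b [ab ee]]] _] := valP e.
have ae : a \in val e by rewrite ee set21.
by have [c h] := coedgeP ae; exists a, c.
Qed.

Lemma coedge_mk x y : x != y -> ~~ adj x y ->
  exists e : coedge G, val e = [set x; y].
Proof.
move=> xy nxy.
have h : (#|[set x; y]| == 2) && independent [set x; y].
  by rewrite cards2 xy indep2 nxy.
by exists (Sub [set x; y] h).
Qed.

Definition is_part P (e : {set G}) :=
  [forall x in e, forall z, rl P x z == (z \in e)].

(* The neighbour of [P] attached to the edge [e] of the complement: [e] becomes a
   part, or is split into singletons when it already is one. *)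
Definition pairmove P (e : {set G}) : rel G := fun x y =>
  if (x \in e) || (y \in e)
  then (x == y) || [&& ~~ is_part P e, x \in e & y \in e] else rl P x y.

Lemma is_partE P (e : {set G}) x z : is_part P e -> x \in e ->
  rl P x z = (z \in e).
Proof. by move=> /forall_inP h xe; have /forallP/(_ z)/eqP := h x xe. Qed.

Lemma pairmoveC P e x y : pairmove P e x y = pairmove P e y x.
Proof.
rewrite /pairmove orbC eq_sym (andbC (x \in e)); case: ifP => // _; exact: rlC.
Qed.

Lemma pairmoveI P Q (e : {set G}) :
  (forall x z, x \in e -> rl Q x z = pairmove P e x z) ->
  (forall x z, x \notin e -> z \notin e -> rl Q x z = rl P x z) ->
  rl Q =2 pairmove P e.
Proof.
move=> h1 h2 x z; have [xe|xe] := boolP (x \in e); first exact: h1.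
have [ze|ze] := boolP (z \in e); first by rewrite rlC pairmoveC h1.
by rewrite h2 // /pairmove (negbTE xe) (negbTE ze).
Qed.

(** The vertex [v] may come out of a larger part; because [x] is alone in [P], the move makes
    [{v, x}] a whole part. *)
Lemma pairmove_join P Q v x : x != v -> rl Q v x -> (forall z, rl P x z = (x == z)) ->
  agree_off (rl P) (rl Q) v -> rl Q =2 pairmove P [set v; x].
Proof.
move=> xv Qvx xal ag.
have npart : is_part P [set v; x] = false.
  apply/negP => h; have := is_partE v h (set22 v x).
  by rewrite xal set21 (negbTE xv).
have Qx z : rl Q v z = (z \in [set v; x]).
  rewrite !inE; have [->|zv] := eqVneq z v; first by rewrite rlxx.
  by rewrite (rl_congr _ Qvx) -ag // xal eq_sym.
apply: pairmoveI => y z.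
  move=> ye; rewrite /pairmove npart ye /=.
  have -> : rl Q y z = (z \in [set v; x]).
    by case/set2P: ye => ->; rewrite // -(rl_congr _ Qvx).
  by case: eqP => [<-|_].
by rewrite !inE !negb_or => /andP[yv _] /andP[zv _]; rewrite ag.
Qed.

(** Let [v] be the vertex that moves. If it leaves mates and joins [x], then [x] was alone, and the
    edge is [{v, x}]. If it leaves mates and becomes alone, its part had two or three vertices, and
    the edge is that pair or the two vertices left behind. If it was alone and joins [x], then [x]
    was alone too, by [good_triple_isolated] and [good_pair_not_extended]. *)
Lemma good_move P Q : good P -> adj P Q ->
  exists e : coedge G, rl Q =2 pairmove P (val e).
Proof.
move=> gP PQ; have /V_adjP[nPQ [v ag]] := PQ.
have ag' : agree_off (rl Q) (rl P) v by move=> y z yv zv; rewrite ag.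
have nvE : ~ (forall z, z != v -> rl P v z = rl Q v z).
  move=> h; apply: nPQ; apply: rl_inj => y z.
  have [->|yv] := eqVneq y v; have [->|zv] := eqVneq z v.
  - by rewrite !rlxx.
  - exact: h.
  - by rewrite rlC h // rlC.
  - exact: ag.
have join x : x != v -> rl Q v x -> (forall z, rl P x z = (x == z)) ->
    exists e : coedge G, rl Q =2 pairmove P (val e).
  move=> xv Qvx xal; have [] := @coedge_mk v x; rewrite 1?eq_sym //.
    exact: rl_nadj Qvx.
  by move=> e ee; exists e; rewrite ee; apply: pairmove_join.
have alone x : ~~ [exists y, (x != y) && rl P x y] -> forall z, rl P x z = (x == z).
  move=> /existsPn h z; have := h z; case: eqP => [->|_]; first by rewrite rlxx.
  by move/negbTE.
have aloneQ x : ~~ [exists y, (x != y) && rl Q x y] -> forall z, rl Q x z = (x == z).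
  move=> /existsPn h z; have := h z; case: eqP => [->|_]; first by rewrite rlxx.
  by move/negbTE.
have [/existsP[b /andP[vb Pvb]]|/alone val_] :=
    boolP [exists b, (v != b) && rl P v b].
  have Pbv z : rl P b z = rl P v z by rewrite (rl_congr _ Pvb).
  have [/existsP[x /andP[vx Qvx]]|/aloneQ Qal] :=
      boolP [exists x, (v != x) && rl Q v x].
    have nvx := rl_nadj Qvx.
    have Pvx : ~~ rl P v x.
      apply/negP => Pvx; apply: nvE => z zv.
      by rewrite (rl_congr _ Pvx) (rl_congr _ Qvx) ag // eq_sym.
    have xb : b != x by apply: contraNneq Pvx => <-.
    apply: (join x); rewrite 1?eq_sym //; apply: alone.
    apply/existsP => -[y /andP[xy Pxy]].
    case: (@good_no_disjoint_mates _ _ P gP v b x y) => //.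
      by apply: contraNneq Pvx => ->; rewrite rlC.
    by apply: contraNneq Pvx => e; rewrite (rl_congr _ Pvb) e rlC.
  have [/existsP[c /and3P[vc bc Pvc]]|/existsPn noc] :=
      boolP [exists c, [&& v != c, b != c & rl P v c]].
    have Pcv z : rl P c z = rl P v z by rewrite (rl_congr _ Pvc).
    have Pv z : rl P v z = (z \in [:: v; b; c]).
      apply/idP/idP => [Pvz|]; first exact: good_class3 Pvz _ _ _.
      by rewrite !inE => /or3P[]/eqP->; rewrite ?rlxx.
    have [] := @coedge_mk b c bc; first by rewrite (rl_nadj (P := P)) // Pbv.
    move=> e ee; exists e; rewrite ee.
    have npart : is_part P [set b; c] = false.
      apply/negP => h; have := is_partE v h (set21 b c).
      by rewrite rlC Pvb !inE (negbTE vb) (negbTE vc).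
    apply: pairmoveI => y z.
      move=> ye; rewrite /pairmove npart ye /=.
      have yv : y != v by case/set2P: ye => ->; rewrite eq_sym.
      have Pyz : rl P y z = (z \in [:: v; b; c]).
        by case/set2P: ye => ->; rewrite ?Pbv ?Pcv Pv.
      have [->|zv] := eqVneq z v.
        by rewrite rlC Qal eq_sym (negbTE yv) !inE (negbTE vb) (negbTE vc).
      rewrite ag' // Pyz !inE (negbTE zv) /=.
      by case: (y =P z) => [<-|//]; move: ye; rewrite !inE.
    have Pv' u : u \notin [set b; c] -> rl P v u = (v == u).
      by rewrite Pv !inE negb_or (eq_sym u v) => /andP[/negbTE-> /negbTE->];
         rewrite !orbF.
    move=> yn zn; have [->|yv] := eqVneq y v; first by rewrite Qal Pv'.
    have [->|zv] := eqVneq z v; first by rewrite rlC Qal rlC Pv'.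
    exact: ag'.
  have Pv z : rl P v z = (z \in [set v; b]).
    apply/idP/idP => [Pvz|/set2P[]->]; rewrite ?rlxx //.
    have := noc z; rewrite Pvz andbT !inE (eq_sym z) (eq_sym z).
    by case: (v == z); case: (b == z).
  have [] := @coedge_mk v b vb; first exact: rl_nadj Pvb.
  move=> e ee; exists e; rewrite ee.
  have part : is_part P [set v; b].
    by apply/forall_inP => y /set2P[]->; apply/forallP => z; rewrite ?Pbv Pv.
  apply: pairmoveI => y z.
    move=> ye; rewrite /pairmove part ye /= orbF.
    case/set2P: ye => ->; first exact: Qal.
    have [->|zv] := eqVneq z v; first by rewrite rlC Qal eq_sym.
    by rewrite ag' ?(eq_sym b v) // Pbv Pv !inE (negbTE zv) eq_sym.
  by rewrite !inE !negb_or => /andP[yv _] /andP[zv _]; apply: ag'.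
have [/existsP[x /andP[vx Qvx]]|/aloneQ Qal] :=
      boolP [exists x, (v != x) && rl Q v x]; last first.
  by case: nvE => z _; rewrite Qal val_.
have xv : x != v by rewrite eq_sym.
apply: (join x) => //; apply: alone; apply/existsP => -[b /andP[xb Pxb]].
have bv : b != v by apply: contraTneq Pxb => ->; rewrite rlC val_.
have Qxb : rl Q x b by rewrite -ag.
have nPxv : ~~ rl P x v by rewrite rlC val_.
(* A third vertex in the part of [x] would make [x] adjacent to [v], which lies outside that part,
   yet [Q] puts [x] and [v] together. *)
have Px z : rl P x z = (z \in [:: x; b]).
  apply/idP/idP => [Pxz|]; last first.
    by rewrite !inE => /orP[]/eqP->; rewrite ?rlxx.
  apply/negPn/negP; rewrite !inE negb_or (eq_sym z) (eq_sym z) => /andP[xz bz].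
  have := good_triple_isolated gP Pxb Pxz xb xz bz nPxv.
  by rewrite adj_sym (negbTE (rl_nadj Qvx)).
by apply: (@good_pair_not_extended _ _ P gP Q x b v).
Qed.

(** If the edges were disjoint, one of them would avoid [v], and by [key] so would the other. Each
    would then consist of the two vertices other than [v] in the triple containing [v], so they
    would meet after all. *)
Lemma pairmove_meet P Q1 Q2 (e1 e2 : coedge G) : good P -> adj Q1 Q2 ->
  rl Q1 =2 pairmove P (val e1) -> rl Q2 =2 pairmove P (val e2) ->
  val e1 :&: val e2 != set0.
Proof.
move=> gP /V_adjP[_ [v ag]] eQ1 eQ2; apply/negP => /eqP dj.
have memF u : u \in val e1 -> u \in val e2 -> False.
  by move=> u1 u2; have := in_set0 u; rewrite -dj inE u1 u2.
(* An edge avoiding [v] consists of two vertices of a triple, the third of which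
   is [v]. *)
have key (e f : coedge G) : (forall u, u \in val e -> u \in val f -> False) ->
    agree_off (pairmove P (val e)) (pairmove P (val f)) v -> v \notin val e ->
    exists x y, [/\ val e = [set x; y], x != y, v \notin [set x; y],
       rl P v x & rl P v y] /\ v \notin val f.
  move=> ef agf ve; have [x [y [ee xy nxy]]] := coedge_ex e; rewrite ee in ve.
  have [xe ye] : x \in val e /\ y \in val e by rewrite ee set21 set22.
  have xf : x \notin val f by apply/negP; apply: ef xe.
  have yf : y \notin val f by apply/negP; apply: ef ye.
  move: (ve); rewrite !inE negb_or => /andP[vx vy].
  have := agf x y; rewrite 1?eq_sym vx 1?eq_sym vy => /(_ isT isT).
  rewrite /pairmove xe ye (negbTE xf) (negbTE yf) (negbTE xy) /= andbT => pE.
  (* The move along [f] leaves [x] and [y] as they are in [P], hence so does the move along [e],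
     which would separate them if [e] were a part. *)
  have npart : ~~ is_part P (val e).
    by apply/negP => h; move: pE; rewrite h (is_partE _ h) // ye.
  rewrite npart in pE; have {pE}Pxy : rl P x y by [].
  have [z zP ze] : exists2 z, rl P x z & z \notin val e.
    move: npart; rewrite negb_forall => /existsP[u]; rewrite negb_imply.
    move=> /andP[ue]; rewrite negb_forall => /existsP[w /negP uw].
    have Pux : rl P x u by move: ue; rewrite ee => /set2P[]->; rewrite ?rlxx.
    exists w; last first.
      apply/negP => we; apply: uw; rewrite we -(rl_congr _ Pux).
      by move: we; rewrite ee => /set2P[]->; rewrite ?rlxx ?Pxy.
    have [//|Pxw] := boolP (rl P x w); case: uw.
    rewrite -(rl_congr _ Pux) (negbTE Pxw) eq_sym eqbF_neg.
    by apply: contra Pxw; rewrite ee => /set2P[]->; rewrite ?rlxx.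
  move: (ze); rewrite ee !inE negb_or => /andP[zx zy].
  (* The other end of [f] would be a nonneighbour of [z] outside the triple [x], [y], [z], against
     [good_triple_isolated]. *)
  have zf : z \notin val f.
    apply/negP => zf; have [w [fe zw nzw]] := coedgeP zf.
    have wf : w \in val f by rewrite fe set22.
    have Pzx : rl P z x by rewrite rlC.
    have Pzy : rl P z y by rewrite -(rl_congr _ zP).
    have Pzw : ~~ rl P z w.
      apply/negP => Pzw; have := good_class3 gP Pzx Pzy Pzw zx zy xy.
      rewrite !inE eq_sym (negbTE zw) /= => /orP[]/eqP we;
      by [rewrite -we wf in xf|rewrite -we wf in yf].
    by move: nzw; rewrite (good_triple_isolated gP Pzx Pzy).
  (* The move along [e] separates [x] from [z] and the move along [f] does not, so [v] is one of
     these two. *)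
  have [vz|vz] := eqVneq v z; last first.
    have := agf x z; rewrite 1?eq_sym vx 1?eq_sym vz => /(_ isT isT).
    rewrite /pairmove xe (negbTE ze) (negbTE xf) (negbTE zf) zP /= !andbF orbF.
    by rewrite eq_sym (negbTE zx).
  exists x, y; rewrite vz; split=> //; split=> //; last first.
  - by rewrite -(rl_congr _ zP).
  - by rewrite rlC.
  - by rewrite -ee.
have ag12 : agree_off (pairmove P (val e1)) (pairmove P (val e2)) v.
  by move=> y z yv zv; rewrite -eQ1 -eQ2 ag.
have ag21 : agree_off (pairmove P (val e2)) (pairmove P (val e1)) v.
  by move=> y z yv zv; rewrite ag12.
have memF' u : u \in val e2 -> u \in val e1 -> False by move=> ? ?; apply: (memF u).
have [v1 v2] : v \notin val e1 /\ v \notin val e2.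
  have [v1|v1] := boolP (v \in val e1).
    have v2 : v \notin val e2 by apply/negP; apply: memF.
    by have [x [y [_]]] := key e2 e1 memF' ag21 v2; rewrite v1.
  by have [x [y [_]]] := key e1 e2 memF ag12 v1.
have [x [y [[ee xy vxy Pvx Pvy] _]]] := key e1 e2 memF ag12 v1.
have [x' [y' [[ee' xy' vxy' Pvx' Pvy'] _]]] := key e2 e1 memF' ag21 v2.
move: vxy vxy'; rewrite !inE !negb_or => /andP[vx vy] /andP[vx' vy'].
have := good_class3 gP Pvx Pvy Pvx' vx vy xy.
rewrite !inE eq_sym (negbTE vx') /= -in_set2 => h; apply: (memF x').
  by rewrite ee.
by rewrite ee' set21.
Qed.

End Moves.

(** * Stars at a full good partition *)

Section Full.
Variables (G : sgraph) (k : nat).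
Local Notation V := (bell_ge G k).
Implicit Types (P Q R : V) (x y v : G).

(** This will hold at the image of the discrete partition as soon as the edge map is a bijection
    that reflects meeting. *)
Definition full P :=
  forall e1 e2 : coedge G, e1 != e2 -> val e1 :&: val e2 != set0 ->
  exists Q1 Q2, [/\ rl Q1 =2 pairmove P (val e1),
                    rl Q2 =2 pairmove P (val e2) & adj Q1 Q2].

Variables (P : V) (gP : good P) (fP : full P).

(** The moves along the meeting edges [{a, x}] and [{x, y}] can be chosen adjacent, so they differ
    at one vertex only. They disagree on the pairs [{a, x}], [{a, b}] and [{x, y}], which have no
    common vertex unless [y] is [a] or [b]. *)
Lemma full_pair a b x y : a != b -> rl P a b -> ~~ rl P a x -> ~~ adj a x ->
  ~~ adj x y -> x != y -> y != a -> y = b.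
Proof.
move=> ab Pab Pax nax nxy xy ya; apply/eqP/negPn/negP => yb.
have ax : a != x by apply: contraNneq Pax => <-; rewrite rlxx.
have bx : b != x by apply: contraNneq Pax => <-.
have ay : a != y by rewrite eq_sym.
have by_ : b != y by rewrite eq_sym.
have [e ee] := coedge_mk ax nax.
have [f fe] := coedge_mk xy nxy.
have ef : e != f.
  apply/eqP => ef; have := set21 a x; rewrite -ee ef fe.
  by rewrite !inE (negbTE ax) (negbTE ay).
have [|Q1 [Q2 [eQ1 eQ2 /V_adjP[_ [v ag]]]]] := fP ef.
  by apply/set0Pn; exists x; rewrite ee fe !inE eqxx orbT.
have np1 : is_part P [set a; x] = false.
  apply/negP => h; have := is_partE x h (set21 a x).
  by rewrite (negbTE Pax) set22.
have np2 : is_part P [set x; y] = false.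
  apply/negP => h; have := is_partE y h (set21 x y); rewrite set22 => Pxy.
  exact: (@good_no_disjoint_mates _ _ P gP a b x y).
have D1 : v = a \/ v = x.
  have [->|av] := eqVneq v a; first by left.
  have [->|xv] := eqVneq v x; first by right.
  have := ag a x; rewrite !(eq_sym _ v) av xv eQ1 eQ2 ee fe /pairmove np1 np2 !inE.
  by rlsimp => /(_ isT isT).
have D2 : v = a \/ v = b.
  have [->|av] := eqVneq v a; first by left.
  have [->|xv] := eqVneq v b; first by right.
  have := ag a b; rewrite !(eq_sym _ v) av xv eQ1 eQ2 ee fe /pairmove np1 np2 !inE.
  by rlsimp => /(_ isT isT).
have D3 : v = x \/ v = y.
  have [->|av] := eqVneq v x; first by left.
  have [->|xv] := eqVneq v y; first by right.
  have := ag x y; rewrite !(eq_sym _ v) av xv eQ1 eQ2 ee fe /pairmove np1 np2 !inE.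
  by rlsimp => /(_ isT isT).
have va : v = a.
  case: D1 => // vx; case: D2 => // vb.
  by move: bx; rewrite -vb -vx eqxx.
by case: D3 => e'; [move: ax|move: ay]; rewrite -e' -va eqxx.
Qed.

(** A mate [w] of [x] other than [u] would have to equal every nonneighbour of [u] other than [u]
    and [x], hence both [y] and [z]. *)
Lemma star_alone u x y z : u != x -> u != y -> u != z -> x != y -> x != z ->
  y != z -> ~~ adj u x -> ~~ adj u y -> ~~ adj u z ->
  forall w, w != u -> rl P x w = (x == w).
Proof.
move=> ux uy uz xy xz yz nx ny nz w wu.
have [<-|xw] := eqVneq x w; first by rewrite rlxx.
apply/negP => Pxw.
suff h t : u != t -> x != t -> ~~ adj u t -> t = w.
  by move: yz; rewrite (h y) // (h z) // eqxx.
move=> ut xt nt; have uw : u != w by rewrite eq_sym.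
have [Pux|Pux] := boolP (rl P u x).
  have Puw : rl P u w by exact: rl_trans Pux Pxw.
  have [Put|Put] := boolP (rl P u t).
    have := good_class3 gP Pux Puw Put ux uw xw.
    by rewrite !inE !(eq_sym t) (negbTE ut) (negbTE xt) /= => /eqP.
  by move: nt; rewrite (good_triple_isolated gP Pux Puw).
apply: (@full_pair x w u t) => //; first by rewrite rlC.
  by rewrite adj_sym.
by rewrite eq_sym.
Qed.

(** Let [u] be the common vertex and [{u, xi}] the edges. A far common neighbour [R] has [u] alone;
    hence, for each [{u, xi}] that is not a part of [P], it agrees with [P] on the vertices other
    than [u] and [xi]. At most one of the pairs is a part, and the two others together force
    agreement off [u], so [R] is not far. *)
Lemma full_star_not_cofar (e1 e2 e3 : coedge G) Q1 Q2 Q3 :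
  rl Q1 =2 pairmove P (val e1) -> rl Q2 =2 pairmove P (val e2) ->
  rl Q3 =2 pairmove P (val e3) ->
  e1 != e2 -> e1 != e3 -> e2 != e3 ->
  val e1 :&: val e2 :&: val e3 != set0 -> ~ cofar P Q1 Q2 Q3.
Proof.
move=> eQ1 eQ2 eQ3 e12 e13 e23 /set0Pn[u]; rewrite !inE.
move=> /andP[/andP[ue1 ue2] ue3] [R [fR a1 a2 a3]].
have [x1 [ee1 ux1 n1]] := coedgeP ue1.
have [x2 [ee2 ux2 n2]] := coedgeP ue2.
have [x3 [ee3 ux3 n3]] := coedgeP ue3.
have dx (e e' : coedge G) x x' : e != e' -> val e = [set u; x] ->
    val e' = [set u; x'] -> x != x'.
  move=> ee' h h'; apply: contraNneq ee' => xx.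
  by apply/eqP; apply: val_inj; rewrite h h' xx.
have x12 : x1 != x2 by exact: dx e12 ee1 ee2.
have x13 : x1 != x3 by exact: dx e13 ee1 ee3.
have x23 : x2 != x3 by exact: dx e23 ee2 ee3.
(* In every [Qi] only [u] has moved: next to [xi], or out of the part [ei]. *)
pose S x := [/\ u != x, ~~ adj u x,
  forall w, w != u -> rl P x w = (x == w) &
  exists2 p, p != u & (forall y, y != u -> y != p ->
      rl R u y = ~~ is_part P [set u; x] && (y == x)) /\
    (forall y z, y != u -> z != u -> y != p -> z != p -> rl R y z = rl P y z)].
have mkS (e : coedge G) x x' x'' Q : val e = [set u; x] ->
    u != x -> u != x' -> u != x'' -> x != x' -> x != x'' -> x' != x'' ->
    ~~ adj u x -> ~~ adj u x' -> ~~ adj u x'' ->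
    rl Q =2 pairmove P (val e) -> adj R Q -> S x.
  move=> ee ux ux' ux'' xx' xx'' x'x'' nx nx' nx'' eQ /V_adjP[_ [p ag]].
  have al : forall w, w != u -> rl P x w = (x == w).
    exact: (@star_alone u x x' x'').
  have agQ : agree_off (rl Q) (rl P) u.
    move=> y z yu zu; rewrite eQ ee /pairmove !inE (negbTE yu) (negbTE zu) /=.
    have [->|yx] := eqVneq y x.
      by rewrite ?eqxx /= al //; have [//|_] := eqVneq x z; rewrite /= ?andbF.
    have [->|zx] := eqVneq z x; last by [].
    by rewrite /= andbF rlC al // orbF eq_sym.
  split=> //; exists p.
    apply/eqP => pu; rewrite pu in ag.
    by apply: (far_agree (v := u) fR) => y z yu zu; rewrite ag // agQ.
  have pu : p != u.
    apply/eqP => pu; rewrite pu in ag.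
    by apply: (far_agree (v := u) fR) => y z yu zu; rewrite ag // agQ.
  split; last by move=> y z yu zu yp zp; rewrite ag // agQ.
  move=> y yu yp; rewrite ag ?(eq_sym u p) // eQ ee /pairmove !inE eqxx /=.
  by rewrite (eq_sym u y) (negbTE yu).
have S1 : S x1 by apply: (mkS e1 x1 x2 x3 Q1).
have S2 : S x2 by apply: (mkS e2 x2 x1 x3 Q2); rewrite // eq_sym.
have S3 : S x3 by apply: (mkS e3 x3 x1 x2 Q3); rewrite // eq_sym.
have onepart x y : x != y -> u != y -> is_part P [set u; x] ->
    is_part P [set u; y] -> False.
  move=> xy uy h1 h2; have := is_partE y h1 (set21 u x).
  by rewrite (is_partE y h2) ?set21 // !inE eqxx orbT !(eq_sym y) (negbTE uy) (negbTE xy).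
(* If [c] were a mate of [u] in [R], it would be the exceptional vertex of every [xi] other than
   [c]; comparing two of these makes both pairs [{u, xi}] parts. *)
have Ru c : c != u -> rl R u c = false.
  move=> cu; apply/negP => Ruc.
  have two x y : S x -> S y -> x != y -> x != c -> y != c -> False.
    move=> [ux _ _ [p pu [h1 _]]] [uy _ _ [q qu [h2 _]]] xy xc yc.
    have pc : p = c.
      apply/eqP; apply: contraNT xc; rewrite eq_sym => cp.
      by move: Ruc; rewrite h1 // => /andP[_ /eqP->].
    have qc : q = c.
      apply/eqP; apply: contraNT yc; rewrite eq_sym => cp.
      by move: Ruc; rewrite h2 // => /andP[_ /eqP->].
    have xu : x != u by rewrite eq_sym.
    have yu : y != u by rewrite eq_sym.
    apply: (@onepart x y) => //.
      have := h1 x xu; rewrite pc => /(_ xc); rewrite h2 ?qc //.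
      by rewrite (negbTE xy) andbF eqxx andbT => /esym/negbFE.
    have := h2 y yu; rewrite qc => /(_ yc); rewrite h1 ?pc //.
    by rewrite (eq_sym y x) (negbTE xy) andbF eqxx andbT => /esym/negbFE.
  have [e|xc] := eqVneq x1 c.
    by apply: (two x2 x3) => //; rewrite -e eq_sym.
  have [e|yc] := eqVneq x2 c; last exact: (two x1 x2).
  by apply: (two x1 x3) => //; rewrite -e eq_sym.
have agx x : S x -> ~~ is_part P [set u; x] -> forall y z, y != u -> z != u ->
    y != x -> z != x -> rl R y z = rl P y z.
  move=> [ux _ _ [p pu [h1 h2]]] npart y z yu zu yx zx.
  have xu : x != u by rewrite eq_sym.
  have [px|px] := eqVneq x p; first by apply: h2; rewrite -?px.
  by have := h1 x xu px; rewrite Ru // npart eqxx.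
have Rpart x y z : S x -> S y -> S z -> x != y -> x != z -> y != z ->
    is_part P [set u; z] -> rl R x y = rl P x y.
  move=> [ux nx alx _] [uy ny _ _] [uz _ _ _] xy xz yz part.
  rewrite alx 1?eq_sym // eq_sym (negbTE xy); apply/negP => Rxy.
  have Puz : rl P u z by rewrite (is_partE z part) ?set21 // set22.
  have Pux : ~~ rl P u x.
    by rewrite (is_partE x part) ?set21 // !inE (eq_sym x u) (negbTE ux) (negbTE xz).
  have := @full_pair u z x y uz Puz Pux nx (rl_nadj Rxy) xy.
  by rewrite eq_sym uy => /(_ isT) e; rewrite e eqxx in yz.
have fin x y z : S x -> S y -> S z -> x != y -> x != z -> y != z ->
    ~~ is_part P [set u; x] -> ~~ is_part P [set u; y] ->
    agree_off (rl R) (rl P) u.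
  move=> Sx Sy Sz xy xz yz px py.
  have Rxy : rl R x y = rl P x y.
    have [pz|pz] := boolP (is_part P [set u; z]); first exact: (@Rpart x y z).
    have [ux _ _ _] := Sx; have [uy _ _ _] := Sy.
    by apply: (agx z); rewrite // eq_sym.
  move=> v w vu wu.
  have [->|vx] := eqVneq v x; have [->|wy] := eqVneq w y => //.
  - have [->|wx] := eqVneq w x; first by rewrite !rlxx.
    have [ux _ _ _] := Sx.
    by apply: (agx y); rewrite // eq_sym.
  - have [->|vy] := eqVneq v y; first by rewrite !rlxx.
    have [_ _ _ _] := Sx; have [uy _ _ _] := Sy.
    by apply: (agx x); rewrite // eq_sym.
  - have [->|wx] := eqVneq w x; last exact: (agx x).
    have [->|vy] := eqVneq v y; first by rewrite rlC Rxy rlC.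
    by have [ux _ _ _] := Sx; apply: (agx y); rewrite // eq_sym.
apply: (far_agree (v := u) fR).
have [p1|p1] := boolP (is_part P [set u; x1]).
  apply: (fin x2 x3 x1) => //; rewrite 1?eq_sym //.
    by apply/negP; apply: onepart p1.
  by apply/negP; apply: onepart p1.
have [p2|p2] := boolP (is_part P [set u; x2]); last exact: (fin x1 x2 x3).
apply: (fin x1 x3 x2) => //; rewrite 1?eq_sym //.
by apply/negP; apply: onepart p2.
Qed.

End Full.

(** * The discrete partition *)

Section Discrete.
Variables (G : sgraph) (k : nat).
Local Notation V := (bell_ge G k).
Implicit Types (P Q R : V) (x y v : G).

(** Deleting one vertex leaves at least one side of the triangle [x], [y], [z]. *)
Lemma nadj3I P Q x y z : rl P x y != rl Q x y -> rl P x z != rl Q x z ->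
  rl P y z != rl Q y z -> x != y -> x != z -> y != z -> ~~ adj P Q.
Proof.
move=> hxy hxz hyz xy xz yz; apply/V_adjP => -[_ [v ag]].
have [xv|xv] := eqVneq x v.
  by move/eqP: hyz; apply; apply: ag; rewrite eq_sym -xv.
have [yv|yv] := eqVneq y v; last by move/eqP: hxy; apply; apply: ag.
by move/eqP: hxz; apply; apply: ag; rewrite // eq_sym -yv.
Qed.

Hypothesis hk : k + 2 <= #|G|.

(** The hypothesis [hk] enters here: partitions with at least [#|G| - 2] parts are always available,
    which covers merging two disjoint pairs or one triple. *)
Lemma exists_V2 (f : G -> G) (a b : G) :
  (forall x y, f x = f y -> ~~ adj x y) -> {in ~: [set a; b] &, injective f} ->
  exists P, forall x y, rl P x y = (f x == f y).
Proof.
move=> pf injf; apply: exists_V pf injf _.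
rewrite -(leq_add2r 2); apply: leq_trans hk _; rewrite -(cardsC [set a; b]) addnC.
by rewrite leq_add2l cards2; case: (a != b).
Qed.

Lemma exists_discrete : exists P, forall x y, rl P x y = (x == y).
Proof.
apply: (@exists_V _ _ _ id [set: G]) => //.
- by move=> x y ->; rewrite adj_irr.
- by rewrite cardsT (leq_trans (leq_addr 2 k)).
Qed.

Variables (P : V) (dP : forall x y, rl P x y = (x == y)).

Lemma pairmove_discrete (e : coedge G) x y :
  pairmove P (val e) x y = (x == y) || ((x \in val e) && (y \in val e)).
Proof.
rewrite /pairmove dP; have -> : is_part P (val e) = false.
  have [a [b [ee ab _]]] := coedge_ex e; apply/negP => h.
  have := is_partE b h; rewrite ee => /(_ a (set21 a b)).
  by rewrite dP set22 (negbTE ab).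
case: ifP => //= /negbT; rewrite negb_or => /andP[/negbTE-> _].
by rewrite orbF.
Qed.

Lemma pairmove_discrete_off (e : coedge G) v : v \in val e ->
  agree_off (pairmove P (val e)) (rl P) v.
Proof.
move=> ve x y xv yv; rewrite pairmove_discrete dP.
have [w [-> _ _]] := coedgeP ve.
rewrite !inE (negbTE xv) (negbTE yv) /=.
by case: eqP => //= nxy; apply/andP => -[/eqP xw /eqP yw]; apply: nxy; rewrite xw.
Qed.

Lemma discrete_nbr Q : adj P Q -> exists e : coedge G, rl Q =2 pairmove P (val e).
Proof.
move=> /V_adjP[nPQ [v ag]].
have [/existsP[x /andP[xv Qvx]]|/existsPn nx] :=
    boolP [exists x, (x != v) && rl Q v x].
  have vx : v != x by rewrite eq_sym.
  have [e ee] := coedge_mk vx (rl_nadj Qvx).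
  by exists e; rewrite ee; apply: pairmove_join.
case: nPQ; apply: rl_inj => x y.
have al z : rl Q v z = (v == z).
  have := nx z; rewrite negb_and negbK => /orP[/eqP->|/negbTE nz].
    by rewrite rlxx eqxx.
  by rewrite nz; apply/esym/negbTE; apply: contraFneq nz => <-; rewrite rlxx.
have [->|xv] := eqVneq x v; first by rewrite dP al.
have [->|yv] := eqVneq y v; first by rewrite rlC dP rlC al.
exact: ag.
Qed.

Lemma discrete_nbr_ex (e : coedge G) :
  exists2 Q, adj P Q & rl Q =2 pairmove P (val e).
Proof.
have [a [b [ee ab nab]]] := coedge_ex e.
pose f z := if z == b then a else z.
have [||Q eQ] := @exists_V2 f b b.
- move=> x y; rewrite /f; case: eqP => [->|_]; case: eqP => [->|_].
  + by rewrite adj_irr.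
  + by move=> <-; rewrite adj_sym.
  + by move=> ->.
  + by move=> ->; rewrite adj_irr.
- move=> x y; rewrite !inE !orbb /f => /negbTE-> /negbTE->.
  by [].
have eQ' : rl Q =2 pairmove P (val e).
  move=> x y; rewrite pairmove_discrete eQ ee /f !inE.
  have [->|xb] := eqVneq x b; have [->|yb] := eqVneq y b.
  - by rewrite eqxx.
  - by rewrite orbT /= orbF eq_sym.
  - by rewrite orbT (negbTE xb) orbF andbT.
  - by rewrite !orbF; case: eqP => //= nxy; apply/esym/andP => -[/eqP xa /eqP ya];
       apply: nxy; rewrite xa.
exists Q => //; have be : b \in val e by rewrite ee set22.
rewrite adj_sym; apply: (@V_adjI _ _ _ _ b).
  apply: (@neqI _ _ _ _ a b); rewrite eQ' pairmove_discrete dP ee set21 set22 orbT.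
  by rewrite (negbTE ab).
by move=> x y xb yb; rewrite eQ' (pairmove_discrete_off be).
Qed.

Lemma pairmove_discrete_inj (e1 e2 : coedge G) :
  pairmove P (val e1) =2 pairmove P (val e2) -> e1 = e2.
Proof.
have sub (e f : coedge G) : pairmove P (val e) =2 pairmove P (val f) ->
    val e \subset val f.
  move=> ef; apply/subsetP => x xe; have [y [ee xy _]] := coedgeP xe.
  have := ef x y; rewrite !pairmove_discrete xe ee set22 (negbTE xy) /=.
  by move/esym/andP=> [].
by move=> e12; apply: val_inj; apply/eqP; rewrite eqEsubset !sub.
Qed.

(** Disjoint edges give two disjoint pairs on which the partitions differ, whereas edges meeting in
    [v] give partitions that both agree with the discrete one off [v]. *)
Lemma discrete_adjE (e1 e2 : coedge G) Q1 Q2 :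
  rl Q1 =2 pairmove P (val e1) -> rl Q2 =2 pairmove P (val e2) ->
  adj Q1 Q2 = (e1 != e2) && (val e1 :&: val e2 != set0).
Proof.
move=> eQ1 eQ2; apply/idP/andP => [Q12|[e12 /set0Pn[v]]].
  split.
    apply/eqP => e12; have := adj_irr Q1; rewrite {2}(_ : Q1 = Q2) ?Q12 //.
    by apply: rl_inj => x y; rewrite eQ1 eQ2 e12.
  apply/negP => /eqP dj.
  have memF u : u \in val e1 -> u \in val e2 -> False.
    by move=> u1 u2; have := in_set0 u; rewrite -dj inE u1 u2.
  have [a [b [ee1 ab _]]] := coedge_ex e1.
  have [c [d [ee2 cd _]]] := coedge_ex e2.
  have [a1 b1] : a \in val e1 /\ b \in val e1 by rewrite ee1 set21 set22.
  have [c2 d2] : c \in val e2 /\ d \in val e2 by rewrite ee2 set21 set22.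
  have ne x y : x \in val e1 -> y \in val e2 -> x != y.
    by move=> x1 y2; apply/eqP => xy; apply: (memF x); rewrite // xy.
  have n2 x : x \in val e1 -> x \in val e2 = false by move=> ?; apply/negP; apply: memF.
  have n1 x : x \in val e2 -> x \in val e1 = false.
    by move=> ?; apply/negP => ?; apply: (memF x).
  move: Q12; apply/negP; apply: (@nadjI _ _ _ _ a b c d).
  - by rewrite eQ1 eQ2 !pairmove_discrete a1 b1 (n2 a) // (negbTE ab).
  - by rewrite eQ1 eQ2 !pairmove_discrete c2 d2 (n1 c) // (negbTE cd).
  - by rewrite !ne.
rewrite inE => /andP[v1 v2].
have [x [ee1 vx _]] := coedgeP v1; have [y [ee2 vy _]] := coedgeP v2.
apply: (@V_adjI _ _ _ _ v); last first.
  move=> z w zv wv; rewrite eQ1 eQ2 (pairmove_discrete_off v1) //.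
  by rewrite (pairmove_discrete_off v2).
apply: (@neqI _ _ _ _ v x); rewrite eQ1 eQ2 !pairmove_discrete v1 v2 ee1 ee2 set22.
rewrite (negbTE vx) !inE (eq_sym x) (negbTE vx) /=.
apply: contraNneq e12 => /esym/eqP xy; apply/eqP; apply: val_inj.
by rewrite ee1 ee2 xy.
Qed.

(** If [R] split [e], the vertex at which [R] and [Q] differ would lie in [e]; off that vertex [Q]
    is discrete, hence so is [R], which is then not far. *)
Lemma far_discrete_edge (e : coedge G) Q R x y : rl Q =2 pairmove P (val e) ->
  far P R -> adj R Q -> x \in val e -> y \in val e -> rl R x y.
Proof.
move=> eQ fR /V_adjP[_ [p ag]] xe ye; apply/negPn/negP => Rxy.
have pe : p \in val e.
  apply: contraNT Rxy => pe; rewrite ag.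
  - by rewrite eQ pairmove_discrete xe ye orbT.
  - by apply: contraNneq pe => <-.
  - by apply: contraNneq pe => <-.
apply: (far_agree (v := p) fR) => z w zp wp.
by rewrite ag // eQ (pairmove_discrete_off pe).
Qed.

(** This yields the uniqueness clause of [good]: [R] keeps both edges together, so it differs from
    [Q1] at a vertex of [e2], whose class is settled through the other end of [e2]. *)
Lemma far_discrete_disjoint (e1 e2 : coedge G) Q1 Q2 R :
  rl Q1 =2 pairmove P (val e1) -> rl Q2 =2 pairmove P (val e2) ->
  val e1 :&: val e2 = set0 -> far P R -> adj R Q1 -> adj R Q2 ->
  forall x y, rl R x y = [|| x == y, (x \in val e1) && (y \in val e1) |
                            (x \in val e2) && (y \in val e2)].
Proof.
move=> eQ1 eQ2 dj fR RQ1 RQ2.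
have R1 := far_discrete_edge eQ1 fR RQ1.
have R2 := far_discrete_edge eQ2 fR RQ2.
have n1 x : x \in val e2 -> x \in val e1 = false.
  by move=> x2; apply/negP => x1; have := in_set0 x; rewrite -dj inE x1 x2.
have /V_adjP[_ [p ag]] := RQ1.
have p2 : p \in val e2.
  apply/negPn/negP => np2; have [c [d [ee2 cd _]]] := coedge_ex e2.
  have [c2 d2] : c \in val e2 /\ d \in val e2 by rewrite ee2 set21 set22.
  have : rl R c d = rl Q1 c d by apply: ag; apply: contraNneq np2 => <-.
  by rewrite R2 // eQ1 pairmove_discrete (negbTE cd) (n1 c).
have [p' [ee2 pp' _]] := coedgeP p2.
have p'2 : p' \in val e2 by rewrite ee2 set22.
have Rp z : z != p -> rl R p z = (z == p').
  move=> zp; rewrite (rl_congr _ (R2 p p' p2 p'2)) ag //; last by rewrite eq_sym.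
  by rewrite eQ1 pairmove_discrete (n1 p') // orbF eq_sym.
move=> x y; have [->|xp] := eqVneq x p; have [->|yp] := eqVneq y p.
- by rewrite rlxx.
- by rewrite Rp // (n1 p) // p2 ee2 !inE (negbTE yp).
- by rewrite rlC Rp // (n1 p) // p2 ee2 !inE (negbTE xp) andbF andbT.
- rewrite ag // eQ1 pairmove_discrete ee2 !inE (negbTE xp) (negbTE yp) /=.
  have [//|xy /=] := eqVneq x y.
  case: (x =P p') => [xp'|_]; last by rewrite orbF.
  case: (y =P p') => [yp'|_]; last by rewrite andbF orbF.
  by rewrite xp' yp' eqxx in xy.
Qed.

Lemma coedge_nadj (e : coedge G) x y : x \in val e -> y \in val e -> ~~ adj x y.
Proof.
have /andP[_ /forall_inP h] := valP e; move=> xe ye.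
by have /forall_inP := h x xe; apply.
Qed.

Lemma exists_far_disjoint (e1 e2 : coedge G) Q1 Q2 :
  rl Q1 =2 pairmove P (val e1) -> rl Q2 =2 pairmove P (val e2) ->
  val e1 :&: val e2 = set0 ->
  exists R, [/\ far P R, adj R Q1 & adj R Q2].
Proof.
move=> eQ1 eQ2 dj.
have n1 x : x \in val e2 -> x \in val e1 = false.
  by move=> x2; apply/negP => x1; have := in_set0 x; rewrite -dj inE x1 x2.
have [a [b [ee1 ab nab]]] := coedge_ex e1.
have [c [d [ee2 cd ncd]]] := coedge_ex e2.
have [a1 b1] : a \in val e1 /\ b \in val e1 by rewrite ee1 set21 set22.
have [c2 d2] : c \in val e2 /\ d \in val e2 by rewrite ee2 set21 set22.
have := n1 c c2; rewrite ee1 !inE => /negbT; rewrite negb_or => /andP[ca cb].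
have := n1 d d2; rewrite ee1 !inE => /negbT; rewrite negb_or => /andP[da db].
(* Each edge is merged into one of its ends, at the cost of two parts. *)
pose f z := if z == b then a else if z == d then c else z.
have fE x y : (f x == f y) = [|| x == y, (x \in val e1) && (y \in val e1) |
                                 (x \in val e2) && (y \in val e2)].
  rewrite /f ee1 ee2 !inE.
  have [->|xb] := eqVneq x b; [|have [->|xd] := eqVneq x d];
    (have [->|yb] := eqVneq y b; [|have [->|yd] := eqVneq y d]);
    rlsimp; rewrite ?andbF ?andbT ?orbF ?orbT //;
    try by rewrite eq_sym.
  - have [//|xy /=] := eqVneq x y.
    case: (x =P a) => [xa|_]; case: (x =P c) => [xc|_] //=.
    + by rewrite -xa eq_sym (negbTE xy) -xc eq_sym (negbTE xy).
    + by rewrite -xa eq_sym (negbTE xy).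
    + by rewrite -xc eq_sym (negbTE xy).
have [||R eR] := @exists_V2 f b d.
- move=> x y /eqP; rewrite fE => /or3P[/eqP->|/andP[h1 h2]|/andP[h1 h2]].
  + by rewrite adj_irr.
  + exact: coedge_nadj h1 h2.
  + exact: coedge_nadj h1 h2.
- move=> x y; rewrite !inE !negb_or /f => /andP[/negbTE-> /negbTE->].
  by move=> /andP[/negbTE-> /negbTE->].
have {}eR x y := etrans (eR x y) (fE x y).
exists R; split.
- apply: (@farI _ _ _ _ a b c d).
  + by rewrite dP eR (negbTE ab) a1 b1.
  + by rewrite dP eR (negbTE cd) c2 d2 orbT.
  + by rewrite !(eq_sym a) !(eq_sym b) ca cb da db.
- apply: (@V_adjI _ _ _ _ c).
    apply: (@neqI _ _ _ _ c d).
    by rewrite eR eQ1 pairmove_discrete c2 d2 (n1 c) // (negbTE cd).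
  move=> x y xc yc; rewrite eR eQ1 pairmove_discrete ee2 !inE (negbTE xc) (negbTE yc).
  have [//|xy /=] := eqVneq x y.
  case: (x =P d) => [xd|_]; rewrite ?orbF //=.
  by rewrite -xd eq_sym (negbTE xy) orbF.
- apply: (@V_adjI _ _ _ _ a).
    apply: (@neqI _ _ _ _ a b).
    have a2 : a \in val e2 = false by apply/negP => /n1; rewrite a1.
    by rewrite eR eQ2 pairmove_discrete a1 b1 a2 (negbTE ab).
  move=> x y xc yc; rewrite eR eQ2 pairmove_discrete ee1 !inE (negbTE xc) (negbTE yc).
  have [//|xy /=] := eqVneq x y.
  case: (x =P b) => [xd|_] //=.
  by rewrite -xd eq_sym (negbTE xy).
Qed.

(** For a star, [R] would join [v], [x2] and [x3], while [Q1] separates these three pairwise, so the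
    two could not be adjacent. For a triangle, the witness has its three vertices as a part. *)
Lemma discrete_cofar (e1 e2 e3 : coedge G) Q1 Q2 Q3 :
  rl Q1 =2 pairmove P (val e1) -> rl Q2 =2 pairmove P (val e2) ->
  rl Q3 =2 pairmove P (val e3) ->
  adj Q1 Q2 -> adj Q2 Q3 -> adj Q1 Q3 ->
  cofar P Q1 Q2 Q3 <-> val e1 :&: val e2 :&: val e3 = set0.
Proof.
move=> eQ1 eQ2 eQ3; rewrite (discrete_adjE eQ1 eQ2) (discrete_adjE eQ2 eQ3).
rewrite (discrete_adjE eQ1 eQ3).
move=> /andP[e12 m12] /andP[e23 m23] /andP[e13 m13]; split.
  move=> [R [fR RQ1 RQ2 RQ3]]; apply/eqP/negPn/negP => /set0Pn[v].
  rewrite !inE => /andP[/andP[v1 v2] v3].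
  have [x1 [ee1 vx1 n1]] := coedgeP v1.
  have [x2 [ee2 vx2 n2]] := coedgeP v2.
  have [x3 [ee3 vx3 n3]] := coedgeP v3.
  have dx (e e' : coedge G) x x' : e != e' -> val e = [set v; x] ->
      val e' = [set v; x'] -> x != x'.
    move=> ee' h h'; apply: contraNneq ee' => xx.
    by apply/eqP; apply: val_inj; rewrite h h' xx.
  have x12 : x1 != x2 by exact: dx e12 ee1 ee2.
  have x13 : x1 != x3 by exact: dx e13 ee1 ee3.
  have x23 : x2 != x3 by exact: dx e23 ee2 ee3.
  have Rv2 : rl R v x2.
    by apply: (far_discrete_edge eQ2) => //; rewrite ee2 set22.
  have Rv3 : rl R v x3.
    by apply: (far_discrete_edge eQ3) => //; rewrite ee3 set22.
  have R23 : rl R x2 x3 by rewrite -(rl_congr _ Rv2).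
  have /V_adjP[_ [p ag]] := RQ1.
  have Q1E x y : rl Q1 x y = (x == y) || (x \in [set v; x1]) && (y \in [set v; x1]).
    by rewrite eQ1 pairmove_discrete ee1.
  have [p2|p2] := eqVneq x2 p.
    have : rl R v x3 = rl Q1 v x3 by apply: ag; rewrite -p2 // eq_sym.
    by rewrite Rv3 Q1E !inE; rlsimp.
  have [p3|p3] := eqVneq x3 p.
    have : rl R v x2 = rl Q1 v x2 by apply: ag; rewrite -p3.
    by rewrite Rv2 Q1E !inE; rlsimp.
  have : rl R x2 x3 = rl Q1 x2 x3 by apply: ag.
  by rewrite R23 Q1E !inE; rlsimp.
move=> nv.
have nov v : v \in val e1 -> v \in val e2 -> v \in val e3 -> False.
  by move=> v1 v2 v3; have := in_set0 v; rewrite -nv !inE v1 v2 v3.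
have /set0Pn[b] := m12; rewrite inE => /andP[b1 b2].
have [a [ee1 ba nba]] := coedgeP b1; have [c [ee2 bc nbc]] := coedgeP b2.
have b3 : b \notin val e3 by apply/negP; apply: nov.
have a3 : a \in val e3.
  have /set0Pn[u] := m13; rewrite inE ee1 => /andP[/set2P[]-> //].
  by rewrite (negbTE b3).
have c3 : c \in val e3.
  have /set0Pn[u] := m23; rewrite inE ee2 => /andP[/set2P[]-> //].
  by rewrite (negbTE b3).
have ac : a != c.
  apply: contraNneq e12 => ac; apply/eqP; apply: val_inj.
  by rewrite ee1 ee2 ac.
have [c' [ee3 ac' nac]] := coedgeP a3.
have {c' ac' nac ee3} [ee3 nac] : val e3 = [set a; c] /\ ~~ adj a c.
  have : c \in [set a; c'] by rewrite -ee3.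
  by rewrite !inE eq_sym (negbTE ac) /= => /eqP->.
pose f z := if (z == b) || (z == c) then a else z.
have fE x y : (f x == f y) = (x == y) ||
    (x \in [:: a; b; c]) && (y \in [:: a; b; c]).
  rewrite /f !inE.
  have [->|xb] := eqVneq x b; [|have [->|xd] := eqVneq x c];
    (have [->|yb] := eqVneq y b; [|have [->|yd] := eqVneq y c]);
    rlsimp; rewrite ?andbF ?andbT ?orbF ?orbT //;
    try by rewrite eq_sym.
  - have [//|xy /=] := eqVneq x y.
    case: (x =P a) => [xa|_] //=.
    by rewrite -xa eq_sym (negbTE xy).
have [||R eR] := @exists_V2 f b c.
- move=> x y /eqP; rewrite fE !inE => /orP[/eqP->|]; first by rewrite adj_irr.
  by move=> /andP[/or3P[]/eqP-> /or3P[]/eqP->]; rewrite ?adj_irr // adj_sym.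
- move=> x y; rewrite !inE /f => /negbTE-> /negbTE->.
  by [].
have {}eR x y := etrans (eR x y) (fE x y).
have ab : a != b by rewrite eq_sym.
have E1 x y : rl Q1 x y = (x == y) || (x \in [set b; a]) && (y \in [set b; a]).
  by rewrite eQ1 pairmove_discrete ee1.
have E2 x y : rl Q2 x y = (x == y) || (x \in [set b; c]) && (y \in [set b; c]).
  by rewrite eQ2 pairmove_discrete ee2.
have E3 x y : rl Q3 x y = (x == y) || (x \in [set a; c]) && (y \in [set a; c]).
  by rewrite eQ3 pairmove_discrete ee3.
exists R; split.
- apply/andP; split.
    by apply: (@neqI _ _ _ _ a b); rewrite eR dP !inE; rlsimp; rewrite ?orbT.
  by apply: (@nadj3I _ _ a b c); rewrite // eR dP !inE; rlsimp; rewrite ?orbT.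
- apply: (@V_adjI _ _ _ _ c).
    by apply: (@neqI _ _ _ _ a c); rewrite eR E1 !inE; rlsimp; rewrite ?orbT.
  move=> x y xc yc; rewrite eR E1 !inE; rlsimp; rewrite ?orbF.
  by rewrite (orbC (x == a)) (orbC (y == a)).
- apply: (@V_adjI _ _ _ _ a).
    by apply: (@neqI _ _ _ _ a c); rewrite eR E2 !inE; rlsimp; rewrite ?orbT.
  by move=> x y xc yc; rewrite eR E2 !inE; rlsimp; rewrite ?orbF.
- apply: (@V_adjI _ _ _ _ b).
    by apply: (@neqI _ _ _ _ a b); rewrite eR E3 !inE; rlsimp; rewrite ?orbT.
  by move=> x y xc yc; rewrite eR E3 !inE; rlsimp; rewrite ?orbF.
Qed.

(** The first two clauses concern disjoint edges. In the third, the first three edges form a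
    triangle; the fourth meets one side in a vertex [v], which also lies on another side. *)
Lemma discrete_good : good P.
Proof.
split.
- move=> Q1 Q2 PQ1 PQ2 Q12 nadj.
  have [e1 eQ1] := discrete_nbr PQ1; have [e2 eQ2] := discrete_nbr PQ2.
  apply: (exists_far_disjoint eQ1 eQ2); apply/eqP/negPn/negP => m12.
  move: nadj; rewrite (discrete_adjE eQ1 eQ2) m12 andbT negbK => /eqP e12.
  by move/eqP: Q12; apply; apply: rl_inj => x y; rewrite eQ1 eQ2 e12.
- move=> Q1 Q2 R1 R2 PQ1 PQ2 Q12 nadj f1 R11 R12 f2 R21 R22.
  have [e1 eQ1] := discrete_nbr PQ1; have [e2 eQ2] := discrete_nbr PQ2.
  have dj : val e1 :&: val e2 = set0.
    apply/eqP/negPn/negP => m12.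
    move: nadj; rewrite (discrete_adjE eQ1 eQ2) m12 andbT negbK => /eqP e12.
    by move/eqP: Q12; apply; apply: rl_inj => x y; rewrite eQ1 eQ2 e12.
  apply: rl_inj => x y.
  rewrite (far_discrete_disjoint eQ1 eQ2 dj f1) //.
  by rewrite (far_discrete_disjoint eQ1 eQ2 dj f2).
- move=> Q1 Q2 Q3 Q4 PQ1 PQ2 PQ3 PQ4 Q12 Q23 Q13 cf Q41 aQ41.
  have [e1 eQ1] := discrete_nbr PQ1; have [e2 eQ2] := discrete_nbr PQ2.
  have [e3 eQ3] := discrete_nbr PQ3; have [e4 eQ4] := discrete_nbr PQ4.
  have nv := (discrete_cofar eQ1 eQ2 eQ3 Q12 Q23 Q13).1 cf.
  have nov v : v \in val e1 -> v \in val e2 -> v \in val e3 -> False.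
    by move=> v1 v2 v3; have := in_set0 v; rewrite -nv !inE v1 v2 v3.
  move: aQ41 Q12 Q13; rewrite (discrete_adjE eQ4 eQ1) (discrete_adjE eQ1 eQ2).
  rewrite (discrete_adjE eQ1 eQ3) => /andP[_ /set0Pn[v]]; rewrite inE.
  move=> /andP[v4 v1] /andP[_ /set0Pn[u]]; rewrite inE => /andP[u1 u2].
  move=> /andP[_ /set0Pn[w]]; rewrite inE => /andP[w1 w3].
  have [t [ee1 vt _]] := coedgeP v1.
  have close (e : coedge G) Q : rl Q =2 pairmove P (val e) -> v \in val e ->
      (Q4 == Q) || adj Q4 Q.
    move=> eQ ve; rewrite (discrete_adjE eQ4 eQ).
    have [e4e|_] := eqVneq e4 e; last first.
      by apply/orP; right; apply/set0Pn; exists v; rewrite inE v4.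
    by rewrite (_ : Q4 = Q) ?eqxx //; apply: rl_inj => x y; rewrite eQ4 eQ e4e.
  have [v2|v3] : v \in val e2 \/ v \in val e3.
    move: (u1) (w1); rewrite ee1 => /set2P[<-|ut]; first by left.
    by move=> /set2P[<-|wt]; [right | case: (nov u) => //; rewrite ut -wt].
  + have /orP[h|h] := close e2 Q2 eQ2 v2; apply/or4P; first exact: Or41.
    exact: Or43.
  + have /orP[h|h] := close e3 Q3 eQ3 v3; apply/or4P; first exact: Or42.
    exact: Or44.
Qed.

End Discrete.

(** * Edges of the complement are determined *)

(** The injections make the two finite sets equally large, so [f] maps the first onto the second. *)
Lemma inj_pair_reflect (X Y : finType) (f : X -> Y) (g : Y -> X)
    (p : pred X) (q : pred Y) :
  injective f -> injective g -> (forall x, p x -> q (f x)) ->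
  (forall y, q y -> p (g y)) -> forall x, q (f x) = p x.
Proof.
move=> injf injg pq qp x; apply/idP/idP => [qfx|]; last exact: pq.
pose A := [set x | p x]; pose B := [set y | q y].
have sub : f @: A \subset B.
  by apply/subsetP => _ /imsetP[z zA ->]; move: zA; rewrite !inE; apply: pq.
have sub' : g @: B \subset A.
  by apply/subsetP => _ /imsetP[z zA ->]; move: zA; rewrite !inE; apply: qp.
have : f @: A == B.
  rewrite eqEcard sub card_imset // -(card_imset _ injg).
  exact: subset_leq_card.
move/eqP/setP/(_ (f x)); rewrite [RHS]inE qfx => /imsetP[z].
by rewrite inE => pz /injf->.
Qed.

(** * Invariance of the local conditions under isomorphism *)

Section Transport.
Variables (B1 B2 : sgraph) (f : B1 -> B2) (g : B2 -> B1).
Hypotheses (fK : cancel f g) (gK : cancel g f).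
Hypothesis fadj : forall x y, adj (f x) (f y) = adj x y.
Let gadj x y : adj (g x) (g y) = adj x y.
Proof. by rewrite -fadj !gK. Qed.

Lemma iso_far P R : far (f P) (f R) = far P R.
Proof. by rewrite /far fadj (can_eq fK). Qed.

Lemma iso_cofar P Q1 Q2 Q3 :
  cofar P Q1 Q2 Q3 -> cofar (f P) (f Q1) (f Q2) (f Q3).
Proof. by move=> [R [h1 h2 h3 h4]]; exists (f R); rewrite iso_far !fadj. Qed.

Lemma iso_good P : good P -> good (f P).
Proof.
move=> [gex guniq gtri]; split.
- move=> Q1 Q2; rewrite -(gK Q1) -(gK Q2) !fadj (can_eq fK) => h1 h2 h3 h4.
  have [R [f1 r1 r2]] := gex _ _ h1 h2 h3 h4.
  by exists (f R); rewrite iso_far !fadj.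
- move=> Q1 Q2 R1 R2; rewrite -(gK Q1) -(gK Q2) -(gK R1) -(gK R2).
  rewrite !fadj !iso_far !(can_eq fK) => h1 h2 h3 h4 h5 h6 h7 h8 h9 h10.
  by congr f; apply: (guniq (g Q1) (g Q2)).
- move=> Q1 Q2 Q3 Q4; rewrite -(gK Q1) -(gK Q2) -(gK Q3) -(gK Q4).
  rewrite !fadj !(can_eq fK) => h1 h2 h3 h4 h5 h6 h7 [R [h8 h9 h10 h11]] h12 h13.
  apply: (gtri (g Q1)) => //; exists (g R).
  by rewrite -iso_far -!fadj gK.
Qed.
End Transport.

Definition meet (G : sgraph) (e f : coedge G) := val e :&: val f != set0.

Definition triangle (G : sgraph) (t : coedge G * coedge G * coedge G) :=
  let: (e, f, h) := t in
  [&& e != f, e != h, f != h, meet e f, meet e h, meet f h &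
      val e :&: val f :&: val h == set0].

(** * The edge map induced by an isomorphism *)

Section EdgeMap.
Variables (G1 G2 : sgraph) (k1 k2 : nat).
Hypotheses (hk1 : k1 + 2 <= #|G1|).
Local Notation V1 := (bell_ge G1 k1).
Local Notation V2 := (bell_ge G2 k2).
Variables (phi : V1 -> V2) (phi' : V2 -> V1).
Hypotheses (phiK : cancel phi phi') (phi'K : cancel phi' phi).
Hypothesis phi_adj : forall x y, adj (phi x) (phi y) = adj x y.

(** The triangle clause is conditional because its proof needs fullness of the image of the discrete
    partition, and this is known only after the inverse isomorphism has been used as well. *)
Definition edge_map (psi : coedge G1 -> coedge G2) :=
  [/\ injective psi, forall e f, meet e f -> meet (psi e) (psi f) &
      bijective psi -> (forall e f, meet (psi e) (psi f) = meet e f) ->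
      forall e f h, triangle (e, f, h) -> triangle (psi e, psi f, psi h)].

Lemma exists_edge_map : exists psi, edge_map psi.
Proof.
have [P dP] := exists_discrete hk1.
have gP := discrete_good hk1 dP.
have gfP : good (phi P) by exact: (iso_good phiK phi'K phi_adj).
have /fin_all_exists[q qP] (e : coedge G1) :
    exists Q : V1, adj P Q /\ rl Q =2 pairmove P (val e).
  by have [Q h1 h2] := discrete_nbr_ex hk1 dP e; exists Q.
have /fin_all_exists[psi psiP] (e : coedge G1) :
    exists e' : coedge G2, rl (phi (q e)) =2 pairmove (phi P) (val e').
  by apply: good_move; rewrite ?phi_adj //; have [] := qP e.
have qE e : rl (q e) =2 pairmove P (val e) by have [] := qP e.
have adjq e f : adj (q e) (q f) = (e != f) && meet e f.
  exact: discrete_adjE.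
exists psi; split.
- move=> e f ef; apply: (pairmove_discrete_inj dP) => x y.
  rewrite -(qE e) -(qE f); suff -> : q e = q f by [].
  apply: (can_inj phiK); apply: rl_inj => z w.
  by rewrite (psiP e) (psiP f) ef.
- move=> e f mef; have [->|ef] := eqVneq e f.
    have [x [y [ee _ _]]] := coedge_ex (psi f).
    by apply/set0Pn; exists x; rewrite setIid ee set21.
  apply: (pairmove_meet gfP _ (psiP e) (psiP f)).
  by rewrite phi_adj adjq ef.
- move=> [psi' psiK psi'K] meetE e f h /and5P[ef eh fh mef /and3P[meh mfh nv]].
  have injpsi := can_inj psiK.
  (* Any two meeting edges of [G2] are images of meeting edges, whose neighbours are adjacent. *)
  have fullP : full (phi P).
    move=> e1 e2 e12 m12; exists (phi (q (psi' e1))), (phi (q (psi' e2))).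
    split.
    + by move=> x y; rewrite psiP psi'K.
    + by move=> x y; rewrite psiP psi'K.
    + by rewrite phi_adj adjq -meetE !psi'K /meet m12 (can_eq psi'K) e12.
  rewrite /= !(inj_eq injpsi) !meetE ef eh fh mef meh mfh /=.
  (* If the image edges formed a star, their partitions could have no far common neighbour, but the
     one of the triangle is carried over by [phi]. *)
  apply/negPn/negP => star.
  have := full_star_not_cofar gfP fullP (psiP e) (psiP f) (psiP h).
  rewrite !(inj_eq injpsi) => /(_ ef eh fh star); apply.
  apply: (iso_cofar phiK phi_adj).
  apply/(discrete_cofar hk1 dP (qE e) (qE f) (qE h)); rewrite ?adjq.
  + by rewrite ef.
  + by rewrite fh.
  + by rewrite eh.
  + exact/eqP.
Qed.
End EdgeMap.

(** The edge maps of the isomorphism and of its inverse are counted against each other, first on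
    edges, then on meeting pairs, then on triangles. *)
Lemma exists_edge_bijection (G1 G2 : sgraph) (k1 k2 : nat) :
  k1 + 2 <= #|G1| -> k2 + 2 <= #|G2| ->
  isomorphic (bell_ge G1 k1) (bell_ge G2 k2) ->
  exists psi : coedge G1 -> coedge G2,
    [/\ bijective psi, forall e f, meet (psi e) (psi f) = meet e f &
        forall e f h, triangle (psi e, psi f, psi h) = triangle (e, f, h)].
Proof.
move=> hk1 hk2 [phi [phi' phiK phi'K] phi_adj].
have phi'_adj x y : adj (phi' x) (phi' y) = adj x y by rewrite -phi_adj !phi'K.
have [psi [inj12 m12 t12]] := exists_edge_map hk1 phiK phi'K phi_adj.
have [psi' [inj21 m21 t21]] := exists_edge_map hk2 phi'K phiK phi'_adj.
have bij12 : bijective psi by apply: inj_card_bij => //; exact: leq_card inj21.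
have bij21 : bijective psi' by apply: inj_card_bij => //; exact: leq_card inj12.
have inj2 (X Y : finType) (f : X -> Y) : injective f ->
    injective (fun t : X * X => (f t.1, f t.2)).
  by move=> injf [a b] [c d] /= [/injf-> /injf->].
have inj3 (X Y : finType) (f : X -> Y) : injective f ->
    injective (fun t : X * X * X => (f t.1.1, f t.1.2, f t.2)).
  by move=> injf [[a b] c] [[a' b'] c'] /= [/injf-> /injf-> /injf->].
have mE e f : meet (psi e) (psi f) = meet e f.
  exact: (inj_pair_reflect (p := fun t => meet t.1 t.2)
    (q := fun t => meet t.1 t.2) (inj2 _ _ _ inj12) (inj2 _ _ _ inj21)
    (fun t => @m12 t.1 t.2) (fun t => @m21 t.1 t.2) (e, f)).
have mE' e f : meet (psi' e) (psi' f) = meet e f.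
  exact: (inj_pair_reflect (p := fun t => meet t.1 t.2)
    (q := fun t => meet t.1 t.2) (inj2 _ _ _ inj21) (inj2 _ _ _ inj12)
    (fun t => @m21 t.1 t.2) (fun t => @m12 t.1 t.2) (e, f)).
exists psi; split=> // e f h.
apply: (inj_pair_reflect (p := @triangle G1) (q := @triangle G2)
    (inj3 _ _ _ inj12) (inj3 _ _ _ inj21) _ _ (e, f, h)).
- by move=> [[a b] c]; apply: t12.
- by move=> [[a b] c]; apply: t21.
Qed.

(** * The complement is determined by its edges *)

(** Both fibres are enumerated, and an element goes to the one of the same rank. *)
Lemma fibre_injection (X Y I : finType) (g1 : X -> I) (g2 : Y -> I) :
  (forall i, #|[set x | g1 x == i]| <= #|[set y | g2 y == i]|) ->
  exists2 h : X -> Y, injective h & forall x, g2 (h x) = g1 x.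
Proof.
move=> le12; have x1 x : x \in [set z | g1 z == g1 x] by rewrite inE.
pose h x := enum_val (widen_ord (le12 (g1 x)) (enum_rank_in (x1 x) x)).
have hP x : g2 (h x) = g1 x by have := enum_valP (widen_ord (le12 (g1 x))
  (enum_rank_in (x1 x) x)); rewrite inE => /eqP.
(* The rank is turned into a plain number, since the ordinal type holding it depends on the
   fibre. *)
have [r [rP lt nE]] : exists r : X -> nat,
    [/\ forall z, nth z (enum [set w | g1 w == g1 z]) (r z) = z,
        forall z, r z < #|[set w | g1 w == g1 z]| &
        forall z y0, h z = nth y0 (enum [set w | g2 w == g1 z]) (r z)].
  exists (fun z => nat_of_ord (enum_rank_in (x1 z) z)); split=> [z|z|z y0].
  - by apply: nth_enum_rank_in; rewrite inE.
  - exact: ltn_ord.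
  - by rewrite /h (enum_val_nth y0).
exists h => // x y hxy; have gxy : g1 x = g1 y by rewrite -!hP hxy.
have rxy : r x = r y.
  move: hxy; rewrite (nE y (h x)) {1}(nE x (h x)) gxy => /eqP.
  rewrite nth_uniq ?enum_uniq -?cardE //; first by move/eqP.
    by rewrite -gxy; apply: leq_trans (lt x) (le12 _).
  exact: leq_trans (lt y) (le12 _).
rewrite -(rP x) -(rP y) rxy gxy; apply: set_nth_default.
by rewrite -cardE lt.
Qed.

(** * Stars in the complement *)

Definition star (G : sgraph) (v : G) : {set coedge G} :=
  [set e : coedge G | v \in val e].

Lemma star_eq (G : sgraph) (v w : G) (e f : coedge G) : v != w ->
  e \in star v -> e \in star w -> f \in star v -> f \in star w -> e = f.
Proof.
rewrite !inE => vw ev ew fv fw; apply: val_inj.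
suff eE (g : coedge G) : v \in val g -> w \in val g -> val g = [set v; w].
  by rewrite (eE e ev ew) (eE f fv fw).
move=> gv gw; have [x [ge _ _]] := coedgeP gv; move: gw.
by rewrite ge => /set2P[wv|->//]; rewrite wv eqxx in vw.
Qed.

Lemma star_ex2 (G : sgraph) (v : G) : 1 < #|star v| ->
  exists e f, [/\ e \in star v, f \in star v & e != f].
Proof. by move=> /card_gt1P[e [f [h1 h2 h3]]]; exists e, f. Qed.

(** Two edges are required because both ends of an isolated edge have the same star. *)
Lemma star_inj (G : sgraph) (v w : G) : 1 < #|star v| ->
  star v \subset star w -> v = w.
Proof.
move=> /star_ex2[e [f [ev fv ef]]] /subsetP sub; apply/eqP/negPn/negP => vw.
by move/eqP: ef; apply; apply: (star_eq vw); rewrite ?sub.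
Qed.

(** Each of the two ends of [e] lies either on [e] alone or on at least two edges. *)
Lemma card_pendant (G : sgraph) (e : coedge G) :
  #|[set v : G | star v == [set e]]| + #|[set v in val e | 1 < #|star v|]| = 2.
Proof.
have /andP[/eqP e2 _] := valP e.
rewrite -[RHS]e2 -(cardsID [set v : G | 1 < #|star v|] (val e)) addnC; congr (_ + _).
  by apply: eq_card => v; rewrite !inE.
apply: eq_card => v; rewrite !inE; apply/eqP/andP => [sv|[dv ev]].
  by rewrite sv cards1; split=> //; have := set11 e; rewrite -sv inE.
apply/eqP; rewrite eq_sym eqEcard sub1set inE ev cards1 /=.
by rewrite leqNgt.
Qed.

Section StarSub.
Variables (G1 G2 : sgraph).
Variables (psi : coedge G1 -> coedge G2) (psi' : coedge G2 -> coedge G1).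
Hypotheses (psiK : cancel psi psi') (psi'K : cancel psi' psi).
Hypothesis psi_meet : forall e f, meet (psi e) (psi f) = meet e f.
Hypothesis psi_tri :
  forall e f h, triangle (psi e, psi f, psi h) = triangle (e, f, h).

(** The images of two edges at [v] meet in some [w]. If the image of a third edge missed [w], the
    three images would form a triangle, although the edges themselves share [v]. *)
Lemma star_sub (v : G1) : 1 < #|star v| ->
  exists w : G2, psi @: star v \subset star w.
Proof.
move=> /star_ex2[e [f [ev fv ef]]].
have vmeet g h : g \in star v -> h \in star v -> meet g h.
  by rewrite !inE => gv hv; apply/set0Pn; exists v; rewrite inE gv.
have /set0Pn[w] : meet (psi e) (psi f) by rewrite psi_meet vmeet.
rewrite inE => /andP[we wf]; exists w; apply/subsetP => _ /imsetP[g gv ->].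
rewrite inE; apply/negPn/negP => wg.
have [eg|eg] := eqVneq e g; first by rewrite -eg we in wg.
have [fg|fg] := eqVneq f g; first by rewrite -fg wf in wg.
have : triangle (psi e, psi f, psi g).
  rewrite /= !psi_meet !vmeet // !(can_eq psiK) ef eg fg /=.
  apply/negPn/negP => /set0Pn[u]; rewrite !inE => /andP[/andP[ue uf] ug].
  have [uw|uw] := eqVneq u w; first by rewrite -uw ug in wg.
  have := @star_eq G2 u w (psi e) (psi f) uw; rewrite !inE.
  by move=> /(_ ue we uf wf)/(can_inj psiK)/eqP; rewrite (negbTE ef).
rewrite psi_tri /= => /and5P[_ _ _ _ /and3P[_ _ /eqP nv]].
by move: ev fv gv; rewrite !inE => ev fv gv; have := in_set0 v; rewrite -nv !inE ev fv gv.
Qed.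
End StarSub.

Section StarImage.
Variables (G1 G2 : sgraph).
Variables (psi : coedge G1 -> coedge G2) (psi' : coedge G2 -> coedge G1).
Hypotheses (psiK : cancel psi psi') (psi'K : cancel psi' psi).
Hypothesis psi_meet : forall e f, meet (psi e) (psi f) = meet e f.
Hypothesis psi_tri :
  forall e f h, triangle (psi e, psi f, psi h) = triangle (e, f, h).

Lemma psi'_meet e f : meet (psi' e) (psi' f) = meet e f.
Proof. by rewrite -psi_meet !psi'K. Qed.
Lemma psi'_tri e f h : triangle (psi' e, psi' f, psi' h) = triangle (e, f, h).
Proof. by rewrite -psi_tri !psi'K. Qed.

(** Applying [star_sub] back along [psi'] leads to a vertex whose star contains that of [v], hence
    to [v] itself. *)
Lemma star_image (v : G1) : 1 < #|star v| ->
  exists w : G2, psi @: star v = star w.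
Proof.
move=> dv; have [w sub] := star_sub psiK psi_meet psi_tri dv.
have dw : 1 < #|star w|.
  by apply: leq_trans dv _; rewrite -(card_imset _ (can_inj psiK)) subset_leq_card.
have [v' sub'] := star_sub psi'K psi'_meet psi'_tri dw.
have vv' : v = v'.
  apply: star_inj => //; apply/subsetP => e ev; rewrite -(psiK e).
  by apply: (subsetP sub'); apply: imset_f; apply: (subsetP sub); apply: imset_f.
exists w; apply/eqP; rewrite eqEsubset sub; apply/subsetP => e ew.
rewrite -(psi'K e); apply: imset_f; rewrite vv'.
by apply: (subsetP sub'); apply: imset_f.
Qed.

(** Ends lying on at least two edges are sent injectively to ends of [psi e] by matching stars. *)
Lemma card_big_ends (e : coedge G1) :
  #|[set v in val e | 1 < #|star v|]| <= #|[set w in val (psi e) | 1 < #|star w|]|.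
Proof.
set A := [set v in _ | _]; set B := [set w in _ | _].
pose h v := [pick w : G2 | psi @: star v == star w].
have hP v : v \in A -> exists2 w, w \in B & h v = Some w /\ psi @: star v = star w.
  rewrite inE => /andP[ve dv]; rewrite /h.
  have [w0 sw0] := star_image dv.
  case: pickP => [w /eqP sw|/(_ w0)]; last by rewrite sw0 eqxx.
  exists w => //; rewrite inE -sw (card_imset _ (can_inj psiK)) dv andbT.
  have : psi e \in star w by rewrite -sw imset_f // inE.
  by rewrite inE.
rewrite -(card_in_imset (f := h) (D := A)); last first.
  move=> v v' vA v'A; have [w _ [-> sw]] := hP v vA.
  have [w' _ [-> sw']] := hP v' v'A => -[ww'].
  apply: star_inj; first by move: vA; rewrite inE => /andP[].
  by rewrite (imset_inj (can_inj psiK) (etrans sw (etrans (congr1 _ ww') (esym sw')))).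
rewrite -(card_imset B (@Some_inj _)); apply: subset_leq_card.
apply/subsetP => _ /imsetP[v vA ->]; have [w wB [-> _]] := hP v vA.
exact: imset_f.
Qed.

End StarImage.

Section FibreLe.
Variables (G1 G2 : sgraph).
Variables (psi : coedge G1 -> coedge G2) (psi' : coedge G2 -> coedge G1).
Hypotheses (psiK : cancel psi psi') (psi'K : cancel psi' psi).
Hypothesis psi_meet : forall e f, meet (psi e) (psi f) = meet e f.
Hypothesis psi_tri :
  forall e f h, triangle (psi e, psi f, psi h) = triangle (e, f, h).

(** A set with at least two edges is the star of at most one vertex. For a single edge the vertices
    are its pendant ends, counted by [card_pendant]. The empty star is excluded: it belongs to the
    universal vertices, whose number the edges do not determine. *)
Lemma star_fibre_le (T : {set coedge G2}) : T != set0 ->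
  #|[set v : G1 | psi @: star v == T]| <= #|[set w : G2 | star w == T]|.
Proof.
rewrite -card_gt0 leq_eqVlt => /orP[|T2].
  rewrite eq_sym => /cards1P[e ->].
  have -> : [set v : G1 | psi @: star v == [set e]] =
            [set v : G1 | star v == [set psi' e]].
    apply/setP => v; rewrite !inE -{1}(psi'K e) -imset_set1.
    by rewrite (inj_eq (imset_inj (can_inj psiK))).
  have aux a b c d : a + b = 2 -> c + d = 2 -> d <= b -> a <= c.
    by move=> ab cd db; rewrite -(leq_add2r b) ab -cd leq_add2l.
  apply: aux (card_pendant (psi' e)) (card_pendant e) _.
  (* Pendant ends are the complementary ones, so the inequality is applied in the reverse direction,
     to [psi']. *)
  exact: (card_big_ends psi'K psiK (psi'_meet psi'K psi_meet) (psi'_tri psi'K psi_tri)).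
have [v|] := pickP [pred v : G1 | psi @: star v == T]; last first.
  by move=> h; rewrite eq_card0 // => v; rewrite inE; apply: h.
move=> /eqP vT.
have dv : 1 < #|star v| by rewrite -(card_imset _ (can_inj psiK)) vT.
have [w sw] := star_image psiK psi'K psi_meet psi_tri dv.
have -> : [set v : G1 | psi @: star v == T] = [set v].
  apply/setP => u; rewrite !inE; apply/eqP/eqP => [uT|->//].
  apply/esym/star_inj => //.
  by rewrite (imset_inj (can_inj psiK) (etrans vT (esym uT))).
by rewrite cards1 card_gt0; apply/set0Pn; exists w; rewrite inE -sw vT.
Qed.
End FibreLe.

(** * Universal vertices and stars *)

Lemma universalP (G : sgraph) (v : G) :
  reflect (forall w, w != v -> adj v w) (universal v).
Proof.
have sub : [set w | adj v w] \subset ~: [set v].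
  by apply/subsetP => w; rewrite !inE; apply: contraTneq => ->; rewrite adj_irr.
have cT : #|~: [set v]| = #|G|.-1 by rewrite cardsC1.
apply: (iffP eqP) => [dv w wv|h].
  have /eqP/setP/(_ w) : [set w | adj v w] == ~: [set v].
    by rewrite eqEcard sub cT /degree -dv /degree leqnn.
  by rewrite !inE wv => ->.
rewrite /degree -cT; apply/eqP; rewrite eqn_leq subset_leq_card //=.
by apply: subset_leq_card; apply/subsetP => w; rewrite !inE; apply: h.
Qed.

Lemma star0 (G : sgraph) (v : G) : (star v != set0) = ~~ universal v.
Proof.
apply/set0Pn/idP => [[e]|].
  rewrite inE => /coedgeP[w [_ vw nvw]]; apply/universalP => /(_ w).
  by rewrite eq_sym vw (negbTE nvw) => /(_ isT).
move=> nuv; have [w wv nvw] : exists2 w, w != v & ~~ adj v w.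
  suff /existsP[w /andP[wv nvw]] : [exists w, (w != v) && ~~ adj v w] by exists w.
  apply: contraNT nuv => /existsPn h; apply/universalP => w wv.
  by have := h w; rewrite wv negbK.
have vw : v != w by rewrite eq_sym.
by have [e ee] := coedge_mk vw nvw; exists e; rewrite inE ee set21.
Qed.

Lemma star_nadj (G : sgraph) (v w : G) : v != w ->
  ~~ adj v w = (star v :&: star w != set0).
Proof.
move=> vw; apply/idP/set0Pn => [nvw|[e]].
  by have [e ee] := coedge_mk vw nvw; exists e; rewrite !inE ee set21 set22.
by rewrite !inE => /andP[ve we]; apply: coedge_nadj ve we.
Qed.

(** Vertices with the same star are matched arbitrarily: only the sizes of the classes of equal
    stars are compared. *)
Lemma star_bijection_half (G1 G2 : sgraph) (psi : coedge G1 -> coedge G2) psi' :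
  cancel psi psi' -> cancel psi' psi ->
  (forall e f, meet (psi e) (psi f) = meet e f) ->
  (forall e f h, triangle (psi e, psi f, psi h) = triangle (e, f, h)) ->
  exists2 h : remove_universal G1 -> remove_universal G2, injective h &
    forall x, star (val (h x)) = psi @: star (val x).
Proof.
move=> psiK psi'K psi_meet psi_tri.
apply: (fibre_injection (g1 := fun x : remove_universal G1 => psi @: star (val x))
  (g2 := fun y : remove_universal G2 => star (val y))) => T.
have [->|T0] := eqVneq T set0.
  rewrite eq_card0 // => v; rewrite inE imset_eq0; apply/negbTE.
  by rewrite star0; have := valP v; rewrite inE.
apply: leq_trans (leq_trans (star_fibre_le psiK psi'K psi_meet psi_tri T0) _).
  rewrite -(card_imset _ val_inj); apply: subset_leq_card.
  by apply/subsetP => _ /imsetP[v + ->]; rewrite !inE.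
rewrite -[leqRHS](card_imset _ val_inj); apply: subset_leq_card.
apply/subsetP => w; rewrite inE => /eqP wT.
have wP : w \in [set v : G2 | ~~ universal v] by rewrite inE -star0 wT.
by apply/imsetP; exists (Sub w wP); rewrite ?SubK // inE SubK wT.
Qed.

(** Distinct vertices are nonadjacent exactly when their stars share an edge, so matching stars
    preserves and reflects adjacency. *)
Lemma isomorphic_of_edge_bijection (G1 G2 : sgraph)
    (psi : coedge G1 -> coedge G2) :
  bijective psi -> (forall e f, meet (psi e) (psi f) = meet e f) ->
  (forall e f h, triangle (psi e, psi f, psi h) = triangle (e, f, h)) ->
  isomorphic (remove_universal G1) (remove_universal G2).
Proof.
move=> [psi' psiK psi'K] psi_meet psi_tri.
have [h injh hP] := star_bijection_half psiK psi'K psi_meet psi_tri.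
have [h' injh' _] := star_bijection_half psi'K psiK
  (psi'_meet psi'K psi_meet) (psi'_tri psi'K psi_tri).
exists h; first by apply: inj_card_bij => //; exact: leq_card injh'.
move=> x y; have [->|xy] := eqVneq x y; first by rewrite !adj_irr.
apply: negb_inj; rewrite /= /induced_adj !star_nadj ?(inj_eq val_inj) ?(inj_eq injh) //.
by rewrite !hP -imsetI ?imset_eq0 // => a b _ _; apply: (can_inj psiK).
Qed.

(** * Number of parts and universal vertices *)

Section Parts.
Variable G : sgraph.

Definition nparts k (P : bell_ge G k) := #|val (val P)|.

Lemma leq_nparts k (P : bell_ge G k) (S : {set G}) :
  {in S &, forall x y, rl P x y -> x = y} -> #|S| <= nparts P.
Proof. exact: (leq_card_partition (V_part P)). Qed.

Lemma nparts_transversal k (P : bell_ge G k) : exists2 S : {set G},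
  {in S &, forall x y, rl P x y -> x = y} & #|S| = nparts P.
Proof. exact: exists_transversal (V_part P). Qed.

(** Different thresholds give different vertex types; this changes the type and keeps the
    partition. *)
Lemma V_cast k k' (P : bell_ge G k) : k' <= nparts P ->
  exists2 Q : bell_ge G k', rl Q =2 rl P & nparts Q = nparts P.
Proof.
move=> kP; have h : val P \in [set P : bell G | k' <= #|val P|] by rewrite inE.
by exists (Sub (val P) h).
Qed.

Lemma chi_leq k (P : bell_ge G k) : chi G <= nparts P.
Proof.
rewrite /chi; case: ex_minnP => c _; apply.
have Pb v : pblock (val (val P)) v \in val (val P).
  by have /and3P[/eqP cP _ _] := V_part P; apply: pblock_mem; rewrite cP inE.
apply/existsP; exists [ffun v => enum_rank_in (Pb v) (pblock (val (val P)) v)].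
apply/forallP => x; apply/forallP => y; apply/implyP; rewrite !ffunE.
apply: contraTneq => exy; apply: (rl_nadj (P := P)).
rewrite /rl /same -(nth_enum_rank_in set0 (Pb x) (Pb x)) exy.
by rewrite nth_enum_rank_in.
Qed.

Lemma exists_chi : exists P : bell_ge G 0, nparts P <= chi G.
Proof.
rewrite /chi; case: ex_minnP => c /existsP[f /forallP fP] _.
have [x y||//|P eP] := @exists_V G 0 _ f set0.
- move=> fxy; have /forallP/(_ y) := fP x; rewrite fxy eqxx implybF.
  by [].
- by move=> x y; rewrite inE.
exists P; have [S injS <-] := nparts_transversal P.
rewrite -(card_in_imset (f := f) (D := S)).
  by rewrite -[leqRHS]card_ord max_card.
by move=> x y xS yS fxy; apply: injS; rewrite // eP fxy.
Qed.

(** Among the partitions with at most [k] parts, one with the fewest equivalent pairs is taken.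
    Unless it is discrete, splitting off a vertex lowers the number of pairs, hence exceeds [k]
    parts, and adds at most one part. *)
Lemma exists_nparts k : chi G <= k <= #|G| -> exists P : bell_ge G 0, nparts P = k.
Proof.
move=> /andP[chik kn]; have [P0 P0chi] := exists_chi.
have P0k : nparts P0 <= k by exact: leq_trans P0chi chik.
pose m (P : bell_ge G 0) := #|[set t : G * G | rl P t.1 t.2]|.
have [P Pk minP] := arg_minnP (P := fun P : bell_ge G 0 => nparts P <= k) m P0k.
exists P; apply/eqP; rewrite eqn_leq Pk /=.
have [/existsP[x /existsP[y /andP[xy Pxy]]]|/existsPn disc] :=
    boolP [exists x, exists y, (x != y) && rl P x y]; last first.
  apply: leq_trans kn _; rewrite -cardsT; apply: leq_nparts => x y _ _ Pxy.
  have /existsPn/(_ y) := disc x; rewrite Pxy andbT negbK; exact: eqP.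
have [Q eQ] := exists_split P x.
have QP : nparts Q <= (nparts P).+1.
  have [S injS <-] := nparts_transversal Q.
  apply: leq_trans (_ : #|S :\ x|.+1 <= _); first by rewrite (cardsD1 x); case: (x \in S).
  rewrite ltnS; apply: leq_nparts => y' z; rewrite !inE => /andP[yx yS] /andP[zx zS].
  by rewrite -(split_agree eQ yx zx); apply: injS.
have Qk : k < nparts Q.
  rewrite ltnNge; apply/negP => /minP; apply/negP; rewrite -ltnNge.
  apply: proper_card; apply/properP; split.
    apply/subsetP => -[a b]; rewrite !inE /= eQ /isorel !inE.
    by case: ifP => // _ /andP[/eqP-> /eqP->]; rewrite rlxx.
  exists (x, y); rewrite !inE //= eQ /isorel !inE eqxx /=.
  by rewrite eq_sym.
by rewrite -ltnS; apply: leq_trans Qk QP.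
Qed.

End Parts.

(** * Partitions of graphs that agree up to universal vertices *)

Section Corr.
Variables (G1 G2 : sgraph).
Variables (f : remove_universal G1 -> remove_universal G2)
          (g : remove_universal G2 -> remove_universal G1).
Hypotheses (fK : cancel f g) (gK : cancel g f).
Hypothesis fadj : forall x y, adj (f x) (f y) = adj x y.

(* Universal vertices are singleton parts, so [corr] determines [P] and [Q] from
   each other. *)
Definition corr k1 k2 (P : bell_ge G1 k1) (Q : bell_ge G2 k2) :=
  forall a b, rl Q (val (f a)) (val (f b)) = rl P (val a) (val b).

Lemma corr_exists k1 (P : bell_ge G1 k1) : exists Q : bell_ge G2 0, corr P Q.
Proof.
(* A nonuniversal vertex is labelled by the part of its preimage and a universal one by itself, the
   sum type keeping the labels apart. *)
pose c (x : G2) : {set G1} + G2 :=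
  if insub x is Some u then inl (pblock (val (val P)) (val (g u))) else inr x.
have cE a : c (val (f a)) = inl (pblock (val (val P)) (val a)).
  by rewrite /c valK fK.
have [||//|Q eQ] := @exists_V G2 0 _ c set0.
- move=> x y; rewrite /c.
  case: insubP => [u _ ux|_]; case: insubP => [v _ vy|_] //.
    move=> [] /eqP h; have := rl_nadj (P := P) h.
    by rewrite -ux -vy; have := fadj (g u) (g v); rewrite /= /induced_adj !gK => ->.
  by move=> [->]; rewrite adj_irr.
- by move=> x y; rewrite inE.
by exists Q => a b; rewrite eQ !cE.
Qed.

Lemma rl_universal (G : sgraph) k (P : bell_ge G k) x y :
  universal x -> rl P x y = (x == y).
Proof.
move=> /universalP ux; apply/idP/eqP => [Pxy|->]; last exact: rlxx.
apply/eqP/negPn/negP => xy; have := rl_nadj Pxy; rewrite ux //.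
by rewrite eq_sym.
Qed.

Lemma nonuniversal_val (G : sgraph) (x : G) : ~~ universal x ->
  exists a : remove_universal G, x = val a.
Proof.
move=> ux; have h : x \in [set v : G | ~~ universal v] by rewrite inE.
by exists (Sub x h); rewrite SubK.
Qed.

Lemma agree_nonuniversal (G : sgraph) k (P Q : bell_ge G k) v :
  (forall a b : remove_universal G, val a != v -> val b != v ->
     rl P (val a) (val b) = rl Q (val a) (val b)) -> agree_off (rl P) (rl Q) v.
Proof.
move=> h x y; have [ux|/nonuniversal_val[a ->]] := boolP (universal x).
  by rewrite !rl_universal.
have [uy|/nonuniversal_val[b ->]] := boolP (universal y); last exact: h.
by rewrite (rlC P) (rlC Q) !rl_universal.
Qed.

Lemma eq_nonuniversal (G : sgraph) k (P Q : bell_ge G k) :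
  (forall a b : remove_universal G,
     rl P (val a) (val b) = rl Q (val a) (val b)) -> P = Q.
Proof.
move=> h; apply: rl_inj => x y.
have [ux|/nonuniversal_val[a ->]] := boolP (universal x).
  by rewrite !rl_universal.
have [uy|/nonuniversal_val[b ->]] := boolP (universal y); last exact: h.
by rewrite (rlC P) (rlC Q) !rl_universal.
Qed.

Lemma corr_inj k1 k2 (P P' : bell_ge G1 k1) (Q : bell_ge G2 k2) :
  corr P Q -> corr P' Q -> P = P'.
Proof. by move=> c c'; apply: eq_nonuniversal => a b; rewrite -c -c'. Qed.

Lemma corr_adj k1 k2 (P P' : bell_ge G1 k1) (Q Q' : bell_ge G2 k2) :
  corr P Q -> corr P' Q' -> adj P P' -> adj Q Q'.
Proof.
move=> c c' /V_adjP[nPP' [v ag]]; apply/V_adjP; split.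
  by move=> e; apply: nPP'; apply: corr_inj c _; rewrite e.
have [uv|/nonuniversal_val[a va]] := boolP (universal v).
  (* A universal vertex is always alone, so partitions that agree off it are equal. *)
  case: nPP'; apply: eq_nonuniversal => a b.
  have nv (d : remove_universal G1) : val d != v.
    by apply: contraTneq uv => <-; have := valP d; rewrite inE.
  by rewrite ag.
exists (val (f a)); apply: agree_nonuniversal => b d.
rewrite -(gK b) -(gK d) !(inj_eq val_inj) !(can_eq fK) c c' => ba da.
by apply: ag; rewrite va (inj_eq val_inj).
Qed.

(** The parts other than universal singletons correspond, and [#|G1|] and [#|G2|] differ exactly by
    the numbers of universal vertices; the sums avoid truncated subtraction. *)
Lemma corr_nparts_leq k1 k2 (P : bell_ge G1 k1) (Q : bell_ge G2 k2) :
  corr P Q -> nparts P + #|G2| <= nparts Q + #|G1|.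
Proof.
move=> c; have [S injS <-] := nparts_transversal P.
pose U1 := [set v : G1 | universal v]; pose U2 := [set v : G2 | universal v].
pose A := [set a : remove_universal G1 | val a \in S].
pose S' := U2 :|: [set val (f a) | a in A].
have cN (G : sgraph) : #|G| = #|[set v : G | universal v]| + #|remove_universal G|.
  rewrite -(cardsC [set v : G | universal v]) /= card_sig; congr (_ + _).
  by apply: eq_card => v; rewrite !inE.
have cS : #|S| <= #|U1| + #|A|.
  rewrite -(card_imset A val_inj); apply: leq_trans (leq_card_setU _ _).
  apply: subset_leq_card; apply/subsetP => x xS; rewrite inE.
  have [ux|/nonuniversal_val[a xa]] := boolP (universal x).
    by rewrite inE ux.
  by apply/orP; right; apply/imsetP; exists a; rewrite ?inE -?xa.
have cS' : #|S'| = #|U2| + #|A|.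
  rewrite cardsU (card_imset A (inj_comp val_inj (can_inj fK))).
  rewrite [X in _ - X]eq_card0 ?subn0 // => x; rewrite !inE.
  apply/andP => -[ux /imsetP[a _ xa]].
  by have := valP (f a); rewrite inE -xa ux.
have S'Q : #|S'| <= nparts Q.
  apply: leq_nparts => x y; rewrite !inE.
  case/orP => [ux|/imsetP[a aA ->]] => [_|]; first by rewrite rl_universal // => /eqP.
  case/orP => [uy|/imsetP[b bA ->]]; first by rewrite rlC rl_universal // => /eqP.
  rewrite c => Pab; congr (val (f _)); apply: val_inj.
  by move: aA bA; rewrite !inE => aS bS; apply: injS.
have cRU : #|remove_universal G1| = #|remove_universal G2|.
  by apply: bij_eq_card; exists g; [exact: fK | exact: gK].
rewrite (cN G1) (cN G2) -cRU -/U1 -/U2.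
apply: leq_trans (_ : #|U1| + #|A| + (#|U2| + #|remove_universal G1|) <= _).
  by rewrite leq_add2r.
by rewrite addnACA (addnC #|U1|) addnACA leq_add2r -cS'.
Qed.

End Corr.

(** * Comparison of the thresholds *)

Section Main.
Variables (G1 G2 : sgraph) (k1 k2 : nat).
Variables (f : remove_universal G1 -> remove_universal G2)
          (g : remove_universal G2 -> remove_universal G1).
Hypotheses (fK : cancel f g) (gK : cancel g f).
Hypothesis fadj : forall x y, adj (f x) (f y) = adj x y.
Let gadj x y : adj (g x) (g y) = adj x y.
Proof. by rewrite -fadj !gK. Qed.

Lemma corr_sym (P : bell_ge G1 k1) (Q : bell_ge G2 k2) : corr f P Q -> corr g Q P.
Proof. by move=> c a b; rewrite -{2}(gK a) -{2}(gK b) c. Qed.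

Lemma corr_nparts (P : bell_ge G1 k1) (Q : bell_ge G2 k2) :
  corr f P Q -> nparts P + #|G2| = nparts Q + #|G1|.
Proof.
move=> c; apply/eqP; rewrite eqn_leq (corr_nparts_leq fK gK c).
exact: (corr_nparts_leq gK fK (corr_sym c)).
Qed.

Lemma corr_exists_ge (P : bell_ge G1 k1) :
  (k2 <= chi G2) \/ (k2 + #|G1| <= nparts P + #|G2|) ->
  exists Q : bell_ge G2 k2, corr f P Q.
Proof.
have [Q0 c0] := corr_exists fK gK fadj P => kP.
have [|Q eQ _] := @V_cast G2 0 k2 Q0; last by exists Q => a b; rewrite eQ c0.
case: kP => [k2chi|]; first exact: leq_trans k2chi (chi_leq Q0).
move=> le; rewrite -(leq_add2r #|G1|); apply: leq_trans le _.
exact: (corr_nparts_leq fK gK c0).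
Qed.

Lemma bell_iso :
  (forall P : bell_ge G1 k1, exists Q : bell_ge G2 k2, corr f P Q) ->
  (forall Q : bell_ge G2 k2, exists P : bell_ge G1 k1, corr g Q P) ->
  isomorphic (bell_ge G1 k1) (bell_ge G2 k2).
Proof.
move=> /fin_all_exists[h hP] /fin_all_exists[h' h'P].
have injh : injective h.
  by move=> P P' e; apply: (corr_inj (hP P)); rewrite e; apply: hP.
have injh' : injective h'.
  by move=> Q Q' e; apply: (corr_inj (h'P Q)); rewrite e; apply: h'P.
exists h; first by apply: inj_card_bij => //; exact: leq_card injh'.
move=> P P'; apply/idP/idP; last exact: (corr_adj fK gK (hP P) (hP P')).
exact: (corr_adj gK fK (corr_sym (hP P)) (corr_sym (hP P'))).
Qed.

(* [corr] embeds the first graph into the second; as they have equally many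
   vertices, every partition in the second one comes from the first. *)
Lemma thresholds_not_binding : #|bell_ge G1 k1| = #|bell_ge G2 k2| ->
  k2 <= #|G2| -> k2 + #|G1| < k1 + #|G2| -> k1 <= chi G1 /\ k2 <= chi G2.
Proof.
move=> card12 k2n lt12.
have ex12 (P : bell_ge G1 k1) : exists Q : bell_ge G2 k2, corr f P Q.
  apply: corr_exists_ge; right; apply: leq_trans (ltnW lt12) _.
  by rewrite leq_add2r; exact: V_card.
have /fin_all_exists[h hP] := ex12.
have injh : injective h.
  by move=> P P' e; apply: (corr_inj (hP P)); rewrite e; apply: hP.
have [h' _ h'K] : bijective h by apply: inj_card_bij; rewrite // card12.
have k2chi : k2 <= chi G2.
  (* Otherwise some partition of [G2] has exactly [k2] parts; its counterpart in [G1] would have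
     fewer than [k1]. *)
  rewrite leqNgt; apply/negP => chik2.
  have [|Q0 Q0k2] := @exists_nparts G2 k2; first by rewrite ltnW.
  have [|Q _ QQ0] := @V_cast G2 0 k2 Q0; first by rewrite Q0k2.
  have := corr_nparts (hP (h' Q)); rewrite h'K QQ0 Q0k2 => e.
  by move: lt12; rewrite -e ltnNge leq_add2r V_card.
(* An optimal colouring of [G1] is sent to [G2], where the threshold is harmless, and comes back
   through [h'] as a vertex of the first graph, so it has at least [k1] parts. *)
split=> //; have [P0 P0chi] := exists_chi G1; apply: leq_trans P0chi.
have [Q0 c0] := corr_exists fK gK fadj P0.
have [|Q eQ _] := @V_cast G2 0 k2 Q0; first exact: leq_trans k2chi (chi_leq Q0).
have [|P eP nP] := @V_cast G1 k1 0 (h' Q); first by [].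
have -> : P0 = P; last by rewrite nP; exact: V_card.
apply: (corr_inj c0) => a b.
by rewrite eP -(hP (h' Q)) h'K eQ.
Qed.
End Main.

(** The sums [k2 + #|G1|] and [k1 + #|G2|] are compared; the two strict cases are symmetric, and
    equality is the second alternative. *)
Lemma thresholds_of_iso (G1 G2 : sgraph) (k1 k2 : nat) :
  k1 <= #|G1| -> k2 <= #|G2| ->
  isomorphic (remove_universal G1) (remove_universal G2) ->
  #|bell_ge G1 k1| = #|bell_ge G2 k2| ->
  (k1 <= chi G1 /\ k2 <= chi G2) \/ #|G1| - k1 = #|G2| - k2.
Proof.
move=> k1n k2n [f [g fK gK] fadj] card12.
have gadj x y : adj (g x) (g y) = adj x y by rewrite -fadj !gK.
have [lt12|lt21|e] := ltngtP (k2 + #|G1|) (k1 + #|G2|).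
- by left; apply: thresholds_not_binding fK gK fadj card12 k2n lt12.
- left; have := thresholds_not_binding gK fK gadj (esym card12) k1n lt21.
  by case.
- right; apply/eqP; rewrite -(eqn_add2r (k1 + k2)) addnA subnK //.
  by rewrite (addnC k1) addnA subnK // addnC e addnC.
Qed.

Theorem theorem1p5 (G1 G2 : sgraph) (k1 k2 : nat)
    (hk1 : k1 + 2 <= #|G1|) (hk2 : k2 + 2 <= #|G2|) :
  isomorphic (bell_ge G1 k1) (bell_ge G2 k2) <->
  isomorphic (remove_universal G1) (remove_universal G2) /\
  ((k1 <= chi G1 /\ k2 <= chi G2) \/ #|G1| - k1 = #|G2| - k2).
Proof.
have k1n : k1 <= #|G1| by exact: leq_trans (leq_addr 2 k1) hk1.
have k2n : k2 <= #|G2| by exact: leq_trans (leq_addr 2 k2) hk2.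
split=> [iso|[[f [g fK gK] fadj] thr]].
  have [psi [bij_psi meet_psi tri_psi]] := exists_edge_bijection hk1 hk2 iso.
  have isoR := isomorphic_of_edge_bijection bij_psi meet_psi tri_psi.
  split=> //; apply: thresholds_of_iso => //.
  by have [phi /bij_eq_card] := iso.
have gadj x y : adj (g x) (g y) = adj x y by rewrite -fadj !gK.
have e12 : #|G1| - k1 = #|G2| - k2 -> k2 + #|G1| = k1 + #|G2|.
  by move=> e; rewrite -{1}(subnK k1n) e addnA subnKC // addnC.
apply: (bell_iso fK gK) => [P|Q]; apply: corr_exists_ge => //.
- case: thr => [[_ ?]|e]; [by left | right].
  by rewrite e12 // leq_add2r V_card.
- case: thr => [[? _]|e]; [by left | right].
  by rewrite -e12 // leq_add2r V_card.
Qed.
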